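(* Let $F,N,M,W$ be smooth functions of the product $UV$, defined near $UV=0$ and non-vanishing at $UV=0$, with $M,N>0$, and consider the five-dimensional metric in coordinates $(U,V,\theta,\phi,\psi)$, $0<\theta<\pi/2$, $$ds^2=2F\,dU\,dV+N\big[W(U\,dV-V\,dU)-\sin^2\theta\,d\phi-\cos^2\theta\,d\psi\big]^2+M\,d\theta^2+M\sin^2\theta\cos^2\theta\,(d\phi-d\psi)^2 .$$ Then, without imposing any field equations: (i) at points with $U=0$ the null covector $\ell=dU$ is a multiple Weyl aligned null direction, i.e. all components of the Weyl tensor of boost weight $+2$ and $+1$ with respect to $\ell$ vanish there; similarly, $n=dV$ is a multiple Weyl aligned null direction at points with $V=0$. Hence the Weyl tensor is at least of type II on either of the horizons $U=0$, $V=0$; (ii) the Weyl tensor is of type D on the bifurcation sphere $U=V=0$. The same statements hold with the Weyl tensor replaced by the Riemann tensor. In particular this applies to the metric, regular at its horizon, of the five-dimensional charged rotating black hole with two equal-magnitude angular momenta, which takes this form in Kruskal-like coordinates near the bifurcation sphere.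
   Context: The covectors $dU$ and $dV$ are null for this metric. Given a null (co)frame with null covectors $\ell,n$, $\ell\cdot n\neq0$, and spacelike covectors $m^{(i)}$, $i=2,3,4$, orthogonal to $\ell$ and $n$, the boost weight of a frame component of a tensor is the power of $\lambda$ it acquires under $\ell\mapsto\lambda\ell$, $n\mapsto\lambda^{-1}n$; for instance $C^{\alpha\beta\gamma\delta}\ell_\alpha m^{(i)}_\beta\ell_\gamma m^{(j)}_\delta$ are the components of the Weyl tensor of boost weight $+2$. A Weyl (or Riemann) tensor at a point is at least of type II if there is a null direction $\ell$ (a multiple aligned null direction) for which all components of positive boost weight vanish, and of type D if there is a null frame in which only the components of boost weight zero may be non-vanishing. *)

(* Defs.v *)
From HB Require Import structures.
From mathcomp Require Import all_boot all_order all_algebra.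
From mathcomp Require Import all_classical all_reals all_analysis.
From mathcomp Require Import ring.
Set Implicit Arguments.
Unset Strict Implicit.
Unset Printing Implicit Defensive.
Import Order.TTheory GRing.Theory Num.Theory.
Import numFieldNormedType.Exports.
Local Open Scope classical_set_scope.
Local Open Scope ring_scope.

Section Curvature.
Context (R : realType) (n : nat).

Definition tensor4 := 'I_n -> 'I_n -> 'I_n -> 'I_n -> R.

(* A metric field assigns to the point with coordinates p the matrix of its
   covariant components; all curvature tensors below have lower indices. *)
Implicit Type g : 'rV[R]_n -> 'M[R]_n.

Definition partial (a : 'I_n) (f : 'rV[R]_n -> R) (p : 'rV[R]_n) : R :=
  'D_(delta_mx 0 a) f p.

(* Gamma^a_{bc} *)
Definition christoffel g (a b c : 'I_n) (p : 'rV[R]_n) : R :=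
  2^-1 * \sum_d invmx (g p) a d *
    (partial b (fun q => g q d c) p + partial c (fun q => g q d b) p
     - partial d (fun q => g q b c) p).

(* R^a_{bcd} = d_c Gamma^a_{db} - d_d Gamma^a_{cb}
               + Gamma^a_{ce} Gamma^e_{db} - Gamma^a_{de} Gamma^e_{cb} *)
Definition riemann_mixed g (p : 'rV[R]_n) (a b c d : 'I_n) : R :=
  partial c (christoffel g a d b) p - partial d (christoffel g a c b) p
  + \sum_e (christoffel g a c e p * christoffel g e d b p
            - christoffel g a d e p * christoffel g e c b p).

Definition riemann g (p : 'rV[R]_n) : tensor4 := fun a b c d =>
  \sum_e g p a e * riemann_mixed g p e b c d.

Definition ricci g (p : 'rV[R]_n) (b d : 'I_n) : R :=
  \sum_a riemann_mixed g p a b a d.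

Definition scalar_curvature g (p : 'rV[R]_n) : R :=
  \sum_b \sum_d invmx (g p) b d * ricci g p b d.

Definition weyl g (p : 'rV[R]_n) : tensor4 := fun a b c d =>
  let G := g p in let Rc := ricci g p in
  riemann g p a b c d
  - (n%:R - 2)^-1 * (G a c * Rc b d - G a d * Rc b c
                     - G b c * Rc a d + G b d * Rc a c)
  + scalar_curvature g p / ((n%:R - 1) * (n%:R - 2))
    * (G a c * G b d - G a d * G b c).

End Curvature.

Section NullFrames.
Context (R : realType) (n : nat).
Implicit Types (G E : 'M[R]_n.+2) (x y ell : 'rV[R]_n.+2).

(* Scalar product of covectors (row vectors) for the metric matrix G. *)
Definition codot G x y : R := (x *m invmx G *m y^T) 0 0.

Definition is_null G ell : Prop := ell != 0 /\ codot G ell ell = 0.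

(* The rows of E are the covectors ell, n, m^(2), m^(3), ... in this order. *)
Definition null_frame G E : Prop :=
  [/\ E \in unitmx,
      codot G (row 0 E) (row 0 E) = 0 /\ codot G (row 1 E) (row 1 E) = 0,
      codot G (row 0 E) (row 1 E) != 0
    & forall i : 'I_n.+2, (1 < i)%N ->
        [/\ 0 < codot G (row i E) (row i E),
            codot G (row 0 E) (row i E) = 0
          & codot G (row 1 E) (row i E) = 0]].

Definition raise4 G (T : tensor4 R n.+2) : tensor4 R n.+2 := fun a b c d =>
  \sum_a' \sum_b' \sum_c' \sum_d'
    invmx G a a' * invmx G b b' * invmx G c c' * invmx G d d' * T a' b' c' d'.

(* T^{abcd} E^(i)_a E^(j)_b E^(k)_c E^(l)_d *)
Definition frame_component G (T : tensor4 R n.+2) E (i j k l : 'I_n.+2) : R :=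
  \sum_a \sum_b \sum_c \sum_d
    raise4 G T a b c d * E i a * E j b * E k c * E l d.

Definition boost_weight1 (i : 'I_n.+2) : int :=
  if i == 0 then 1 else if i == 1 then -1 else 0.

Definition boost_weight (i j k l : 'I_n.+2) : int :=
  boost_weight1 i + boost_weight1 j + boost_weight1 k + boost_weight1 l.

Definition boost (lam : R) E : 'M[R]_n.+2 :=
  \matrix_(i, a) (lam ^ boost_weight1 i * E i a).

(* boost_weight is the power of lam acquired under ell |-> lam ell,
   n |-> lam^-1 n. *)
Lemma frame_component_boost G (T : tensor4 R n.+2) E (lam : R) i j k l :
  lam != 0 ->
  frame_component G T (boost lam E) i j k l =
  lam ^ boost_weight i j k l * frame_component G T E i j k l.
Proof.
move=> lam0; rewrite /frame_component /boost_weight !expfzDr // mulr_sumr.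
apply: eq_bigr => a _; rewrite mulr_sumr; apply: eq_bigr => b _.
rewrite mulr_sumr; apply: eq_bigr => c _; rewrite mulr_sumr.
by apply: eq_bigr => d _; rewrite !mxE; ring.
Qed.

(* The property does not depend on how ell is completed to a null frame; the
   second conjunct only guarantees that it can be. *)
Definition multiple_aligned G (T : tensor4 R n.+2) ell : Prop :=
  [/\ is_null G ell,
      exists E, null_frame G E /\ row 0 E = ell
    & forall E, null_frame G E -> row 0 E = ell ->
      forall i j k m, 0 < boost_weight i j k m ->
        frame_component G T E i j k m = 0].

Definition at_least_typeII G (T : tensor4 R n.+2) : Prop :=
  exists ell, multiple_aligned G T ell.

Definition typeD G (T : tensor4 R n.+2) : Prop :=
  exists E, null_frame G E /\
    forall i j k m, boost_weight i j k m != 0 ->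
      frame_component G T E i j k m = 0.

End NullFrames.

Section Smooth.
Context (R : realType).

Definition smooth_near (c eps : R) (f : R -> R) : Prop :=
  forall (k : nat) (x : R), `|x - c| < eps -> derivable (derive1n k f) x 1.

End Smooth.

Section LineElements.
Context (R : realType).

Definition ix0 : 'I_5 := @Ordinal 5 0 isT.
Definition ix1 : 'I_5 := @Ordinal 5 1 isT.
Definition ix2 : 'I_5 := @Ordinal 5 2 isT.
Definition ix3 : 'I_5 := @Ordinal 5 3 isT.
Definition ix4 : 'I_5 := @Ordinal 5 4 isT.

(* Covector of the k-th coordinate differential. *)
Definition dx (k : 'I_5) : 'rV[R]_5 := delta_mx 0 k.

(* Symmetrised product of covectors, as it is used in a line element:
   sprod a a is a^2 and 2 *: sprod a b is 2 a b. *)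
Definition sprod (a b : 'rV[R]_5) : 'M[R]_5 :=
  2^-1 *: (a^T *m b + b^T *m a).

Definition ssq (a : 'rV[R]_5) : 'M[R]_5 := sprod a a.

(* Coordinates (U, V, theta, phi, psi). *)
Definition kruskal_metric (F N M W : R -> R) (p : 'rV[R]_5) : 'M[R]_5 :=
  let U := p 0 ix0 in let V := p 0 ix1 in let theta := p 0 ix2 in
  let dU := dx ix0 in let dV := dx ix1 in
  let dtheta := dx ix2 in let dphi := dx ix3 in let dpsi := dx ix4 in
  let x := U * V in
  (2 * F x) *: sprod dU dV
  + N x *: ssq (W x *: (U *: dV - V *: dU)
                - sin theta ^+ 2 *: dphi - cos theta ^+ 2 *: dpsi)
  + M x *: ssq dtheta
  + (M x * sin theta ^+ 2 * cos theta ^+ 2) *: ssq (dphi - dpsi).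

Record kruskal_data (eps : R) (F N M W : R -> R) : Prop := {
  kruskal_eps : 0 < eps;
  kruskal_smoothF : smooth_near 0 eps F;
  kruskal_smoothN : smooth_near 0 eps N;
  kruskal_smoothM : smooth_near 0 eps M;
  kruskal_smoothW : smooth_near 0 eps W;
  kruskal_F0 : F 0 != 0;
  kruskal_W0 : W 0 != 0;
  kruskal_N_gt0 : forall x, `|x| < eps -> 0 < N x;
  kruskal_M_gt0 : forall x, `|x| < eps -> 0 < M x }.

(* Claims (i) and (ii) for a curvature tensor field T of the metric g, in
   coordinates (U, V, theta, phi, psi). *)
Definition horizon_types (g : 'rV[R]_5 -> 'M[R]_5)
    (T : 'rV[R]_5 -> tensor4 R 5) : Prop :=
  forall p : 'rV[R]_5, 0 < p 0 ix2 < pi / 2 ->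
    [/\ p 0 ix0 = 0 -> multiple_aligned (g p) (T p) (dx ix0),
        p 0 ix1 = 0 -> multiple_aligned (g p) (T p) (dx ix1),
        p 0 ix0 = 0 \/ p 0 ix1 = 0 -> at_least_typeII (g p) (T p)
      & p 0 ix0 = 0 /\ p 0 ix1 = 0 -> typeD (g p) (T p)].

(* Stationary metric of a rotating black hole with two equal-magnitude angular
   momenta, in coordinates (t, r, theta, phi, psi):
   - f dt^2 + dr^2 / h + N (omega dt - sin^2 theta dphi - cos^2 theta dpsi)^2
   + M dtheta^2 + M sin^2 theta cos^2 theta (dphi - dpsi)^2. *)
Definition black_hole_metric (f h omega N M : R -> R) (p : 'rV[R]_5) :
    'M[R]_5 :=
  let r := p 0 ix1 in let theta := p 0 ix2 in
  let dt := dx ix0 in let dr := dx ix1 in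
  let dtheta := dx ix2 in let dphi := dx ix3 in let dpsi := dx ix4 in
  - f r *: ssq dt + (h r)^-1 *: ssq dr
  + N r *: ssq (omega r *: dt
                - sin theta ^+ 2 *: dphi - cos theta ^+ 2 *: dpsi)
  + M r *: ssq dtheta
  + (M r * sin theta ^+ 2 * cos theta ^+ 2) *: ssq (dphi - dpsi).

(* Regular non-extremal horizon at r = rH, with angular velocity omega rH; the
   last condition is what makes W non-zero on the horizon. *)
Record regular_horizon (rH delta : R) (f h omega N M : R -> R) : Prop := {
  horizon_delta : 0 < delta;
  horizon_smoothf : smooth_near rH delta f;
  horizon_smoothh : smooth_near rH delta h;
  horizon_smoothomega : smooth_near rH delta omega;
  horizon_smoothN : smooth_near rH delta N;
  horizon_smoothM : smooth_near rH delta M;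
  horizon_N_gt0 : forall r, `|r - rH| < delta -> 0 < N r;
  horizon_M_gt0 : forall r, `|r - rH| < delta -> 0 < M r;
  horizon_f0 : f rH = 0;
  horizon_h0 : h rH = 0;
  horizon_df_gt0 : 0 < derive1 f rH;
  horizon_dh_gt0 : 0 < derive1 h rH;
  horizon_domega : derive1 omega rH != 0 }.

(* (U, V, theta, phi', psi') |-> (t, r, theta, phi, psi) in the exterior
   region U, V > 0, with co-rotating angles phi = phi' + OmegaH t and
   psi = psi' + OmegaH t. *)
Definition kruskal_chart (kappa OmegaH : R) (rho : R -> R) (p : 'rV[R]_5) :
    'rV[R]_5 :=
  let U := p 0 ix0 in let V := p 0 ix1 in
  let t := ln (V / U) / (2 * kappa) in
  t *: dx ix0 + rho (U * V) *: dx ix1 + p 0 ix2 *: dx ix2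
  + (p 0 ix3 + OmegaH * t) *: dx ix3 + (p 0 ix4 + OmegaH * t) *: dx ix4.

(* Row i of the library's jacobian matrix holds the partial derivatives with
   respect to the i-th coordinate, hence the place of the transpose. *)
Definition pullback (Phi : 'rV[R]_5 -> 'rV[R]_5) (g : 'rV[R]_5 -> 'M[R]_5)
    (p : 'rV[R]_5) : 'M[R]_5 :=
  'J Phi p *m g (Phi p) *m ('J Phi p)^T.

(* The metric g in coordinates (t, r, theta, phi, psi) takes the form
   kruskal_metric F N M W in the exterior part of a neighbourhood of the
   bifurcation sphere, r = rH corresponding to U V = 0. *)
Record takes_kruskal_form (g : 'rV[R]_5 -> 'M[R]_5)
    (rH delta kappa OmegaH eps : R) (rho F N M W : R -> R) : Prop := {
  kform_kappa : 0 < kappa;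
  kform_rho_smooth : smooth_near 0 eps rho;
  kform_rho0 : rho 0 = rH;
  kform_drho_gt0 : forall x, `|x| < eps -> 0 < derive1 rho x;
  kform_rho_dom : forall x, `|x| < eps -> `|rho x - rH| < delta;
  kform_metric : forall p : 'rV[R]_5,
    0 < p 0 ix0 -> 0 < p 0 ix1 -> p 0 ix0 * p 0 ix1 < eps ->
    0 < p 0 ix2 < pi / 2 ->
    let Phi := kruskal_chart kappa OmegaH rho in
    [/\ differentiable Phi p, 'J Phi p \in unitmx
      & pullback Phi g p = kruskal_metric F N M W p] }.

End LineElements.

(* Main.v *)
Require Import Defs.
From HB Require Import structures.
From mathcomp Require Import all_boot all_order all_algebra.
From mathcomp Require Import all_classical all_reals all_analysis.
From mathcomp Require Import perm ring lra zify.
Set Implicit Arguments.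
Unset Strict Implicit.
Unset Printing Implicit Defensive.
Import Order.TTheory GRing.Theory Num.Theory.
Import numFieldNormedType.Exports.
Local Open Scope classical_set_scope.
Local Open Scope ring_scope.

(** The metric is invariant under the boosts (U, V) |-> (lam U, V / lam), hence so
    are its curvature tensors.  On U = 0 the boosts drag a point to the
    bifurcation sphere U = V = 0, where the curvature is continuous; a coordinate
    component with more lower V than lower U indices is multiplied by a positive
    power of the scale on the way, so it vanishes on U = 0.  There the vector dual
    to dU is along the V axis and every spacelike frame vector has no U component,
    which turns this into the vanishing of all frame components of positive boost
    weight.  On U = V = 0 both horizons contribute, whence type D.

    For the black hole put f = (r - rH) f1 and h = (r - rH) h1 with f1, h1 > 0.
    U and V are null iff x = U V satisfies 2 kappa x dr/dx = sqrt (f h); with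
    2 kappa = sqrt (f1 h1)(rH) this equation is regular at the horizon, and its
    solution r = rho(x) is smooth there.  F and W are then Hadamard quotients by x
    of f o rho and omega o rho. *)

(** * Differentiable functions *)

(** No curvature component is ever computed. The argument uses only how the curvature scales under
    boosts and that it is continuous, and continuity is drawn from repeated Fréchet
    differentiability of the metric on an open, boost-invariant set. Two obstacles shape the proof.
    Alignment is claimed for every completion of dU or dV to a null frame, so the weight count may
    use only what orthogonality imposes on the other frame vectors, not a particular frame. And in
    the equation for r the coefficient of dr/dx vanishes at x = 0, so the equation is not fed to an
    existence theorem: x is written down as an explicit function of r, by splitting off the pole of
    its logarithmic derivative at the horizon, and then inverted. Smoothness of Hadamard quotients
    is obtained in the same spirit, from a differential equation that is stable under
    differentiation. *)

Lemma near_eq_differentiable (R : realType) (V : normedModType R)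
    (f g : V -> R) p :
  {near p, f =1 g} -> differentiable f p -> differentiable g p.
Proof.
move=> fg df; have [dc /eqaddoP de] := (diff_locallyP _ _).1 df.
have E : g \o shift p = cst (g p) + 'd f p +o_ (0 : V) id.
  apply/eqaddoP => e e0.
  have fgp : f p = g p by apply: nbhs_singleton fg.
  have := de e e0; apply: filterS2.
  2:{ have : \forall q \near p, f q = g q by exact: fg.
  rewrite (near_shift 0 p) => h; exact: h. }
  by move=> x /=; rewrite !fctE /= subr0 => -> ; rewrite fgp.
by apply/diff_locallyP; rewrite (diff_unique dc E).
Qed.

(** Recursion on directional derivatives keeps every derivative real-valued, so that closure under
    algebra and composition is a plain induction on [k]. Order 0 says nothing, not even continuity;
    continuity starts at order 1. *)
Fixpoint ndiff (R : realType) (V : normedModType R) (D : set V) (k : nat)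
    (f : V -> R) : Prop :=
  if k is k'.+1 then
    (forall p, D p -> differentiable f p) /\
    forall v, ndiff D k' (fun p => 'D_v f p)
  else True.

Definition smooth_on (R : realType) (V : normedModType R) (D : set V)
  (f : V -> R) := forall k, ndiff D k f.

Section NDiff.
Context (R : realType) (V : normedModType R) (D : set V).
Hypothesis Dopen : open D.
Implicit Types (f g u : V -> R) (k : nat).

Lemma ndiffS k f : ndiff D k.+1 f -> ndiff D k f.
Proof. by elim: k f => [//|k IH] f [df Df]; split=> // v; apply: IH. Qed.

(** Openness of [D] turns equality on [D] into equality near each of its points, which is what
    derivatives see. This lets each closure lemma replace a derivative by its formula on [D]. *)
Lemma eq_ndiff k f g : (forall p, D p -> f p = g p) ->
  ndiff D k f -> ndiff D k g.
Proof.
elim: k f g => [//|k IH] f g fg [df Df].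
have nfg p : D p -> {near p, f =1 g}.
  move=> Dp; have : \forall q \near p, D q by exact: open_nbhs_nbhs.
  by apply: filterS => q; apply: fg.
split=> [p Dp|v]; first exact: near_eq_differentiable (nfg p Dp) (df p Dp).
apply: (IH (fun p => 'D_v f p)); last exact: Df.
by move=> p Dp; apply: near_eq_derive; apply: nfg.
Qed.

Lemma ndiff_cst k (c : R) : ndiff D k (fun=> c).
Proof.
elim: k c => [//|k IH] c; split=> [p _|v]; first exact: differentiable_cst.
by apply: (@eq_ndiff k (fun=> 0)) => [p _|]; [rewrite derive_cst | exact: IH].
Qed.

Lemma ndiffD k f g : ndiff D k f -> ndiff D k g -> ndiff D k (fun p => f p + g p).
Proof.
elim: k f g => [//|k IH] f g [df Df] [dg Dg]; split=> [p Dp|v].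
  by apply: (@differentiableD _ _ _ f g); auto.
apply: (@eq_ndiff k (fun p => 'D_v f p + 'D_v g p)); last exact: IH (Df v) (Dg v).
by move=> p Dp; rewrite -[RHS]/('D_v (f + g) p) deriveD //;
     [apply: diff_derivable; exact: df|apply: diff_derivable; exact: dg].
Qed.

Lemma ndiffM k f g : ndiff D k f -> ndiff D k g -> ndiff D k (fun p => f p * g p).
Proof.
elim: k f g => [//|k IH] f g kf kg; have [df Df] := kf; have [dg Dg] := kg.
split=> [p Dp|v]; first by apply: (@differentiableM _ _ f g); auto.
apply: (@eq_ndiff k (fun p => f p * 'D_v g p + g p * 'D_v f p)).
  by move=> p Dp; rewrite -[RHS]/('D_v (f * g) p) deriveM //;
     [apply: diff_derivable; exact: df|apply: diff_derivable; exact: dg].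
by apply: ndiffD; apply: IH; (exact: ndiffS || exact: Df || exact: Dg).
Qed.

Lemma ndiffZ k (c : R) f : ndiff D k f -> ndiff D k (fun p => c * f p).
Proof. by apply: ndiffM; apply: ndiff_cst. Qed.

Lemma ndiffN k f : ndiff D k f -> ndiff D k (fun p => - f p).
Proof. by move=> /(ndiffZ (-1)); apply: eq_ndiff => p _; rewrite mulN1r. Qed.

Lemma ndiffB k f g : ndiff D k f -> ndiff D k g -> ndiff D k (fun p => f p - g p).
Proof. by move=> kf kg; apply: ndiffD => //; apply: ndiffN. Qed.

Lemma ndiff_sum k (I : Type) (r : seq I) (P : pred I) (F : I -> V -> R) :
  (forall i, P i -> ndiff D k (F i)) -> ndiff D k (fun p => \sum_(i <- r | P i) F i p).
Proof.
move=> kF; elim: r => [|i r IH].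
  by apply: eq_ndiff (ndiff_cst k 0) => p _; rewrite big_nil.
case Pi: (P i).
  by apply: eq_ndiff (ndiffD (kF i Pi) IH) => p _; rewrite big_cons Pi.
by apply: eq_ndiff IH => p _; rewrite big_cons Pi.
Qed.

Lemma ndiff_prod k (I : Type) (r : seq I) (P : pred I) (F : I -> V -> R) :
  (forall i, P i -> ndiff D k (F i)) -> ndiff D k (fun p => \prod_(i <- r | P i) F i p).
Proof.
move=> kF; elim: r => [|i r IH].
  by apply: eq_ndiff (ndiff_cst k 1) => p _; rewrite big_nil.
case Pi: (P i).
  by apply: eq_ndiff (ndiffM (kF i Pi) IH) => p _; rewrite big_cons Pi.
by apply: eq_ndiff IH => p _; rewrite big_cons Pi.
Qed.

Lemma ndiffX k f n : ndiff D k f -> ndiff D k (fun p => f p ^+ n).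
Proof.
move=> kf; elim: n => [|n IH]; first exact: eq_ndiff (ndiff_cst k 1).
by apply: eq_ndiff (ndiffM kf IH) => p _; rewrite exprS.
Qed.

(* First-order ODE bootstrap: each derivative gained on the right is gained on the left. *)
Lemma ndiff_ode k f n (a : V -> V -> R) :
  (forall p, D p -> differentiable f p) ->
  (forall v p, D p -> 'D_v f p = a v p * f p ^+ n) ->
  (forall v, ndiff D k (a v)) -> ndiff D k.+1 f.
Proof.
move=> df fE; elim: k => [|k IH] ka; first by split.
split=> // v; apply: (@eq_ndiff _ (fun p => a v p * f p ^+ n)).
  by move=> p Dp; rewrite fE.
apply: ndiffM; first exact: ka.
by apply/ndiffX/IH => w; apply/ndiffS/ka.
Qed.

Lemma ndiffV k f : (forall p, D p -> f p != 0) ->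
  ndiff D k f -> ndiff D k (fun p => (f p)^-1).
Proof.
move=> f0; case: k => [//|k] [df Df].
(* The derivative of 1/f is - f' (1/f)^2, which has the bootstrap form with exponent 2. *)
apply: (@ndiff_ode _ _ 2 (fun v p => - 'D_v f p)) => [p Dp|v p Dp|v].
- by apply: differentiableV; auto.
- rewrite -[LHS]/('D_v (fun y => (f y)^-1) p) deriveV; auto; last first.
    by apply: diff_derivable; auto.
  by rewrite -exprVn /GRing.scale /= mulNr mulNr mulrC.
- exact: ndiffN (Df v).
Qed.

Lemma derive_comp1 (phi : R -> R) f p v :
  differentiable f p -> derivable phi (f p) 1 ->
  'D_v (phi \o f) p = 'D_1 phi (f p) * 'D_v f p.
Proof.
move=> df /derivable1_diffP dphi; rewrite deriveE; last exact: differentiable_comp.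
rewrite diff_comp //= !deriveE //; set w := 'd f p v.
by rewrite -[in LHS](mulr1 w) [LHS]linearZ mulrC.
Qed.

Lemma ndiff_comp1 k (I : set R) (phi : R -> R) f :
  (forall p, D p -> I (f p)) -> ndiff I k phi -> ndiff D k f ->
  ndiff D k (fun p => phi (f p)).
Proof.
move=> DI; elim: k phi => [//|k IH] phi [dphi Dphi] kf; have [df Df] := kf.
split=> [p Dp|v]; first by apply: differentiable_comp; auto.
apply: (@eq_ndiff _ (fun p => 'D_1 phi (f p) * 'D_v f p)).
  move=> p Dp; rewrite -derive_comp1 //; first exact: df.
  by apply/derivable1_diffP; auto.
exact: ndiffM (IH _ (Dphi 1) (ndiffS kf)) (Df v).
Qed.

Lemma ndiff_continuous f p : ndiff D 1 f -> D p -> {for p, continuous f}.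
Proof. by move=> [df _] Dp; apply: differentiable_continuous; apply: df. Qed.

End NDiff.

(** * Smooth functions of one real variable *)

Section OneVariable.
Context (R : realType).
Implicit Types (f : R -> R) (D : set R).

Lemma ndiff_derive1 D k f : open D ->
  (forall p, D p -> derivable f p 1) -> ndiff D k (derive1 f) -> ndiff D k.+1 f.
Proof.
move=> Do df kf; split=> [p Dp|v]; first by apply/derivable1_diffP; apply: df.
apply: (@eq_ndiff _ _ _ Do k (fun p => v * derive1 f p)); last exact: ndiffZ.
move=> p Dp; rewrite derive1E; have /derivable1_diffP dfp := df p Dp.
by rewrite !deriveE // -[in RHS](mulr1 v) [RHS]linearZ.
Qed.

Lemma smooth_derive1 D f : smooth_on D f -> smooth_on D (derive1 f).
Proof.
move=> sf k; have [_ /(_ 1)] := sf k.+1.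
by rewrite (_ : (fun p => 'D_1 f p) = derive1 f) // funeqE => p; rewrite derive1E.
Qed.

Lemma smooth_derivable D f p : smooth_on D f -> D p -> derivable f p 1.
Proof. by move=> sf Dp; apply/derivable1_diffP; have [df _] := sf 1; apply: df. Qed.

Lemma smooth_derive1n D f k : smooth_on D f -> smooth_on D (derive1n k f).
Proof. by move=> sf; elim: k => [//|k IH]; rewrite derive1nS; apply: smooth_derive1. Qed.

(** In one variable derivability is Fréchet differentiability and ['D_v f] is [v] times [derive1 f],
    so the condition on iterated derivatives and [smooth_on] agree. All smoothness hypotheses enter,
    and all smoothness conclusions leave, through this equivalence. *)
Lemma smooth_nearP c eps f :
  smooth_near c eps f <-> smooth_on [set x | `|x - c| < eps] f.
Proof.
have Bo : open [set x : R | `|x - c| < eps].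
  rewrite (_ : [set x | _] = ball c eps); first exact: ball_open.
  by apply/seteqP; split=> x /=; rewrite -ball_normE /= distrC.
split=> [sf k|sf k x xc]; last exact: smooth_derivable (smooth_derive1n k sf) xc.
elim: k f sf => [//|k IH] f sf; apply: ndiff_derive1 => //.
  by move=> p; apply: (sf 0).
by apply: IH => j x xc; rewrite -derive1Sn; apply: (sf j.+1).
Qed.

Lemma smooth_expR D : open D -> smooth_on D (@expR R).
Proof.
(* The exponential solves the bootstrap equation with exponent 1 and constant coefficient. *)
move=> Do [//|k]; apply: (@ndiff_ode _ _ _ Do _ _ 1 (fun v _ => v)).
- by move=> p _; apply/derivable1_diffP.
- move=> v p _; have /derivable1_diffP d : derivable (@expR R) p 1 by [].
  rewrite deriveE // -[in LHS](mulr1 v) [LHS]linearZ /= expr1.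
  by congr (_ * _); exact: etrans (esym (@deriveE R R R expR p 1 d)) (congr1 (@^~ p) (@derive_expR R)).
- by move=> v; apply: ndiff_cst.
Qed.

Lemma smooth_sin_cos D : open D -> smooth_on D (@sin R) /\ smooth_on D (@cos R).
Proof.
move=> Do; suff H k : ndiff D k (@sin R) /\ ndiff D k (@cos R).
  by split=> k; case: (H k).
elim: k => [//|k [IHs IHc]]; split; apply: ndiff_derive1 => //.
  by rewrite (_ : derive1 _ = cos) // funeqE => x; rewrite derive1E derive_val.
rewrite (_ : derive1 _ = (fun x => - sin x)); first exact: ndiffN.
by rewrite funeqE => x; rewrite derive1E derive_val.
Qed.
End OneVariable.

(** * Curvature under linear rescalings of the coordinates *)

Section CurvatureRegularity.
Context (R : realType) (n : nat) (D : set 'rV[R]_n).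
Hypothesis Dopen : open D.
Implicit Types (g : 'rV[R]_n -> 'M[R]_n) (k : nat).

Lemma ndiff_det m k (A : 'rV[R]_n -> 'M[R]_m) :
  (forall i j, ndiff D k (fun p => A p i j)) -> ndiff D k (fun p => \det (A p)).
Proof.
move=> kA; apply: ndiff_sum => // s _; apply: ndiffM => //; first exact: ndiff_cst.
exact: ndiff_prod.
Qed.

Lemma ndiff_invmx m k (A : 'rV[R]_n -> 'M[R]_m) i j :
  (forall p, D p -> A p \in unitmx) ->
  (forall i j, ndiff D k (fun p => A p i j)) ->
  ndiff D k (fun p => invmx (A p) i j).
Proof.
move=> Au kA.
(* Cramer's rule reduces the inverse to determinants, which are polynomial in the entries. *)
apply: (@eq_ndiff _ _ _ Dopen _ (fun p => (\det (A p))^-1 * (\adj (A p)) i j)).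
  by move=> p Dp; rewrite /invmx Au // !mxE.
apply: ndiffM => //.
  apply: ndiffV => //; last exact: ndiff_det.
  by move=> p Dp; rewrite -unitfE -unitmxE; apply: Au.
apply: (@eq_ndiff _ _ _ Dopen _ (fun p => (-1) ^+ (j + i) *
    \det (row' j (col' i (A p))))); first by move=> p _; rewrite mxE.
apply: ndiffZ => //; apply: ndiff_det => a b.
by apply: (eq_ndiff Dopen _ (kA (lift j a) (lift i b))) => p _; rewrite !mxE.
Qed.

Variable g : 'rV[R]_n -> 'M[R]_n.
Hypothesis gu : forall p, D p -> g p \in unitmx.

(** One order is spent here and another in the Riemann tensor. Continuity of the curvature, which is
    order 1 of [ndiff], thus costs order 3 of the metric. *)
Lemma ndiff_christoffel k a b c :
  (forall i j, ndiff D k.+1 (fun p => g p i j)) -> ndiff D k (christoffel g a b c).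
Proof.
move=> kg.
have kp i j l : ndiff D k (partial i (fun q => g q j l)).
  by have [_ /(_ (delta_mx 0 i))] := kg j l.
apply: ndiffZ => //; apply: ndiff_sum => // d _; apply: ndiffM => //.
  by apply: ndiff_invmx => // i j; apply: ndiffS.
by apply: ndiffB => //; apply: ndiffD.
Qed.

Lemma ndiff_riemann_mixed k a b c d :
  (forall i j, ndiff D k.+2 (fun p => g p i j)) ->
  ndiff D k (fun p => riemann_mixed g p a b c d).
Proof.
move=> kg.
have kG i j l : ndiff D k.+1 (christoffel g i j l) by exact: ndiff_christoffel.
have kG' i j l : ndiff D k (christoffel g i j l) by exact: ndiffS.
have kp e i j l : ndiff D k (partial e (christoffel g i j l)).
  by have [_ /(_ (delta_mx 0 e))] := kG i j l.
apply: ndiffD => //; first exact: ndiffB.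
by apply: ndiff_sum => // e _; apply: ndiffB => //; apply: ndiffM.
Qed.

Lemma ndiff_riemann k a b c d :
  (forall i j, ndiff D k.+2 (fun p => g p i j)) ->
  ndiff D k (fun p => riemann g p a b c d).
Proof.
move=> kg; apply: ndiff_sum => // e _; apply: ndiffM => //.
  exact/ndiffS/ndiffS.
exact: ndiff_riemann_mixed.
Qed.

Lemma ndiff_ricci k b d :
  (forall i j, ndiff D k.+2 (fun p => g p i j)) ->
  ndiff D k (fun p => ricci g p b d).
Proof. by move=> kg; apply: ndiff_sum => // e _; apply: ndiff_riemann_mixed. Qed.

Lemma ndiff_weyl k a b c d :
  (forall i j, ndiff D k.+2 (fun p => g p i j)) ->
  ndiff D k (fun p => weyl g p a b c d).
Proof.
move=> kg; have kr i j := ndiff_ricci i j kg.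
have kg0 i j : ndiff D k (fun p => g p i j) by exact/ndiffS/ndiffS.
have ks : ndiff D k (fun p => scalar_curvature g p).
  apply: ndiff_sum => // i _; apply: ndiff_sum => // j _; apply: ndiffM => //.
  exact: ndiff_invmx.
have kgr i j l m : ndiff D k (fun p => g p i j * ricci g p l m).
  exact: ndiffM.
have kgg i j l m : ndiff D k (fun p => g p i j * g p l m) by exact: ndiffM.
apply: ndiffD => //; last first.
  apply: ndiffM => //; last exact: ndiffB.
  by apply: ndiffM => //; apply: ndiff_cst.
apply: ndiffB => //; first exact: ndiff_riemann.
apply: ndiffZ => //; apply: ndiffD => //.
by apply: ndiffB => //; apply: ndiffB.
Qed.

End CurvatureRegularity.

Lemma differentiable_rV (R : realType) (V : normedModType R) n
    (f : V -> 'rV[R]_n) p :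
  (forall i, differentiable (fun q => f q 0 i) p) -> differentiable f p.
Proof.
move=> df; rewrite (_ : f = \sum_(i < n) (fun q => f q 0 i *: delta_mx 0 i)).
  by apply: differentiable_sum => i; apply: differentiableZl.
by apply/funext => q; rewrite fct_sumE {1}[f q]row_sum_delta.
Qed.

Section Dilation.
Context (R : realType) (n : nat) (b : 'I_n -> R).
Hypothesis b0 : forall i, b i != 0.

(** Boosts of (U, V) are diagonal in the coordinates, so every tensor component is merely multiplied
    by a number: [b] for each lower index, its inverse for an upper one. The hypothesis [gE] below
    says that the map is an isometry of [g]. *)
Definition dilate (p : 'rV[R]_n) : 'rV[R]_n := \row_a (b a * p 0 a).

Lemma dilate_is_linear : linear dilate.
Proof. by move=> c x y; apply/rowP => a; rewrite !mxE; ring. Qed.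

HB.instance Definition _ :=
  GRing.isLinear.Build R 'rV[R]_n 'rV[R]_n *:%R dilate dilate_is_linear.

Lemma differentiable_dilate p : differentiable dilate p.
Proof.
apply: differentiable_rV => i.
rewrite (_ : (fun _ => _) = b i *: (fun q : 'rV[R]_n => q 0 i)); last first.
  by apply/funext => q; rewrite mxE.
exact/differentiableZ/differentiable_coord.
Qed.

Lemma continuous_dilate : continuous dilate.
Proof. by move=> p; apply/differentiable_continuous/differentiable_dilate. Qed.

Lemma dilate_delta a : dilate (delta_mx 0 a) = b a *: delta_mx 0 a.
Proof.
by apply/rowP => i; rewrite !mxE eqxx /=; case: eqVneq => [->|]; rewrite ?mulr0.
Qed.

Lemma partial_dilate (f : 'rV[R]_n -> R) a p : differentiable f (dilate p) ->
  partial a (fun q => f (dilate q)) p = b a * partial a f (dilate p).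
Proof.
move=> df; have dd := differentiable_dilate p.
rewrite /partial deriveE; last exact: differentiable_comp.
rewrite -[fun q => _]/(f \o dilate) diff_comp //= deriveE //.
have -> : 'd dilate p (delta_mx 0 a) = b a *: delta_mx 0 a.
  have := @diff_lin R 'rV[R]_n 'rV[R]_n dilate p continuous_dilate.
  by move=> /(congr1 (@^~ (delta_mx 0 a))) /= ->; rewrite dilate_delta.
by rewrite linearZ.
Qed.

Lemma partialZ (f : 'rV[R]_n -> R) (c : R) a p : differentiable f p ->
  partial a (fun q => c * f q) p = c * partial a f p.
Proof.
by move=> df; rewrite /partial -[fun q => _]/(c *: f) deriveZ //; apply: diff_derivable.
Qed.

Variable D : set 'rV[R]_n.
Hypotheses (Dopen : open D) (Ddil : forall p, D p -> D (dilate p)).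
Variable g : 'rV[R]_n -> 'M[R]_n.
Hypothesis gu : forall p, D p -> g p \in unitmx.
Hypothesis gk : forall i j, ndiff D 2 (fun p => g p i j).
Hypothesis gE : forall p i j, g p i j = b i * b j * g (dilate p) i j.

Lemma partial_dilateE (f : 'rV[R]_n -> R) c a p : D p -> ndiff D 1 f ->
  (forall q, D q -> f q = c * f (dilate q)) ->
  partial a f p = c * b a * partial a f (dilate p).
Proof.
move=> Dp [df _] fE.
have dfp : differentiable f (dilate p) by apply/df/Ddil.
rewrite -mulrA -partial_dilate // -partialZ; last first.
  by apply: differentiable_comp => //; apply: differentiable_dilate.
apply: near_eq_derive; have : \forall q \near p, D q by exact: open_nbhs_nbhs.
by apply: filterS => q; apply: fE.
Qed.

Lemma invmx_dilate p i j : D p ->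
  invmx (g p) i j = (b i)^-1 * (b j)^-1 * invmx (g (dilate p)) i j.
Proof.
move=> Dp; pose A := \matrix_(i, j) ((b i)^-1 * (b j)^-1 * invmx (g (dilate p)) i j).
suff -> : invmx (g p) = A by rewrite mxE.
have gAE : g p *m A = 1%:M.
  rewrite -(mulmxV (gu (Ddil Dp))); apply/matrixP => x y; rewrite !mxE.
  transitivity (b x / b y * \sum_k g (dilate p) x k * invmx (g (dilate p)) k y).
    rewrite mulr_sumr; apply: eq_bigr => k _; rewrite (gE p) !mxE.
    by field; rewrite !b0.
  have /matrixP/(_ x y) := mulmxV (gu (Ddil Dp)); rewrite !mxE => ->.
  by case: eqVneq => [->|_]; rewrite ?mulr0 // mulr1 divff.
by rewrite -[invmx _]mulmx1 -gAE mulKmx // gu.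
Qed.

(** The inhomogeneous term in the transformation law of the Christoffel symbols contains second
    derivatives of the coordinate change, which vanish for a linear map; so here they scale like a
    tensor. *)
Lemma christoffel_dilate a i j p : D p ->
  christoffel g a i j p = (b a)^-1 * b i * b j * christoffel g a i j (dilate p).
Proof.
move=> Dp; rewrite /christoffel mulrCA; congr (_ * _).
rewrite mulr_sumr; apply: eq_bigr => d _; rewrite invmx_dilate //.
have pE x y z : partial x (fun q => g q y z) p =
    b y * b z * b x * partial x (fun q => g q y z) (dilate p).
  by apply: partial_dilateE => //; apply: ndiffS.
by rewrite !pE; field; rewrite !b0.
Qed.

Lemma riemann_mixed_dilate p i j k l : D p ->
  riemann_mixed g p i j k l =
  (b i)^-1 * b j * b k * b l * riemann_mixed g (dilate p) i j k l.
Proof.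
move=> Dp.
have pE x y z w : partial x (christoffel g y z w) p =
    (b y)^-1 * b z * b w * b x * partial x (christoffel g y z w) (dilate p).
  apply: partial_dilateE => //; first exact: (ndiff_christoffel Dopen gu).
  by move=> q Dq; apply: christoffel_dilate.
rewrite /riemann_mixed !pE mulrDr; congr (_ + _).
  by move: (partial k _ _) (partial l _ _) => P Q; ring.
rewrite mulr_sumr; apply: eq_bigr => e _; rewrite !(christoffel_dilate _ _ _ Dp).
by field; rewrite !b0.
Qed.

Lemma riemann_dilate p i j k l : D p ->
  riemann g p i j k l = b i * b j * b k * b l * riemann g (dilate p) i j k l.
Proof.
move=> Dp; rewrite /riemann mulr_sumr; apply: eq_bigr => e _.
by rewrite riemann_mixed_dilate // (gE p); field; rewrite b0.
Qed.

Lemma ricci_dilate p i j : D p ->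
  ricci g p i j = b i * b j * ricci g (dilate p) i j.
Proof.
move=> Dp; rewrite /ricci mulr_sumr; apply: eq_bigr => e _.
by rewrite riemann_mixed_dilate //; field; rewrite b0.
Qed.

Lemma scalar_curvature_dilate p : D p ->
  scalar_curvature g p = scalar_curvature g (dilate p).
Proof.
move=> Dp; apply: eq_bigr => i _; apply: eq_bigr => j _.
by rewrite ricci_dilate // invmx_dilate //; field; rewrite !b0.
Qed.

Lemma weyl_dilate p i j k l : D p ->
  weyl g p i j k l = b i * b j * b k * b l * weyl g (dilate p) i j k l.
Proof.
move=> Dp; rewrite /weyl riemann_dilate // !(ricci_dilate _ _ Dp).
rewrite scalar_curvature_dilate //.
rewrite !(gE p); set c1 := (_ - _)^-1; set c2 := _ / _; ring.
Qed.

End Dilation.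

(** * Frame components *)

Section Contraction.
Context (R : realType) (n : nat).
Implicit Types (G E : 'M[R]_n.+2) (T : tensor4 R n.+2).

Lemma sum4E (I : finType) (f : I -> I -> I -> I -> R) :
  \sum_a \sum_b \sum_c \sum_d f a b c d =
  \sum_(x : I * I * I * I) f x.1.1.1 x.1.1.2 x.1.2 x.2.
Proof. by rewrite pair_bigA pair_bigA pair_bigA; apply: eq_bigr => -[[[]]]. Qed.

Lemma mulr_sum4 (I : finType) (f g h k : I -> R) :
  \sum_a \sum_b \sum_c \sum_d (f a * g b * h c * k d) =
  (\sum_a f a) * (\sum_b g b) * (\sum_c h c) * (\sum_d k d).
Proof.
rewrite -!mulrA mulr_suml; apply: eq_bigr => a _.
rewrite mulr_suml mulr_sumr; apply: eq_bigr => b _.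
rewrite mulr_suml !mulr_sumr; apply: eq_bigr => c _.
by rewrite !mulr_sumr; apply: eq_bigr => d _; rewrite !mulrA.
Qed.

(** Index raising is moved from [T] to the frame: the rows of [X] are the frame vectors metrically
    dual to the covectors, and only coordinate components of [T] remain. *)
Lemma frame_componentE G T E i j k l :
  let X := E *m invmx G in
  frame_component G T E i j k l =
  \sum_a \sum_b \sum_c \sum_d T a b c d * (X i a * X j b * X k c * X l d).
Proof.
move=> X; rewrite /frame_component sum4E.
under eq_bigr => x _ do rewrite /raise4 sum4E !mulr_suml.
rewrite exchange_big sum4E /=; apply: eq_bigr => y _.
rewrite /X !mxE -mulr_sum4 sum4E mulr_sumr; apply: eq_bigr => x _.
by rewrite /=; ring.
Qed.

(** A non-zero summand would force 0 <= sum of [w] <= - sum of [u] < 0. The weights [w] of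
    coordinate indices and [u] of frame indices are kept apart and arbitrary, because the two
    horizons need opposite signs. *)
Lemma frame_component_eq0 G T E (u w : 'I_n.+2 -> int) i j k l :
  (forall a b c d, T a b c d != 0 -> 0 <= w a + w b + w c + w d) ->
  (forall i a, (E *m invmx G) i a != 0 -> w a <= - u i) ->
  0 < u i + u j + u k + u l -> frame_component G T E i j k l = 0.
Proof.
move=> Tw Xw u_gt0; rewrite frame_componentE /=.
apply: big1 => a _; apply: big1 => b _; apply: big1 => c _; apply: big1 => d _.
apply/eqP/negPn/negP; rewrite !mulf_eq0 !negb_or.
move=> /andP[/Tw T0] /andP[/andP[/andP[/Xw Xi /Xw Xj] /Xw Xk] /Xw Xl].
by move: T0 Xi Xj Xk Xl u_gt0; lia.
Qed.

Lemma codot_row G E i j :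
  codot G (row i E) (row j E) = (E *m invmx G *m E^T) i j.
Proof.
by rewrite /codot -row_mul [LHS]mxE [RHS]mxE; apply: eq_bigr => k _; rewrite !mxE.
Qed.

Lemma codotC G x y : G^T = G -> codot G x y = codot G y x.
Proof.
move=> Gsym; rewrite /codot; set A := LHS; have -> : A = ((x *m invmx G *m y^T)^T) 0 0 by rewrite [RHS]mxE.
by rewrite !trmx_mul trmxK trmx_inv Gsym mulmxA.
Qed.

End Contraction.

(** The right-hand side tends to 0 because the exponent is positive and [h] is bounded near 0. The
    equation is available only for [s != 0], hence the limit over the punctured neighbourhood. *)
Lemma scaled_limit_eq0 (R : realType) (x : R) (h : R -> R) m :
  (forall s, s != 0 -> x = s ^+ m.+1 * h s) -> {for 0, continuous h} -> x = 0.
Proof.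
move=> xE hc; have c0 : (fun s => s ^+ m.+1 * h s) @ (0 : R) --> (0 : R).
  rewrite -[X in _ --> X](_ : 0 ^+ m.+1 * h 0 = 0); last by rewrite exprS !mul0r.
  by apply: cvgM => //; apply: exprn_continuous.
have c1 : (fun s => s ^+ m.+1 * h s) @ 0^' --> (0 : R) by apply: cvg_within_filter c0.
have c2 : (fun s => s ^+ m.+1 * h s) @ 0^' --> x.
  apply: (@cvg_trans _ ((fun=> x) @ 0^')); last exact: cvg_cst.
  apply: near_eq_cvg; near=> s; apply: xE.
  by near: s; apply: nbhs_dnbhs_neq.
exact: (cvg_unique _ c2 c1).
Unshelve. all: by end_near. Qed.

(** * The Kruskal coframe *)

Section Frame.
Context (R : realType) (F N M W : R -> R).
Implicit Type p : 'rV[R]_5.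

(** The covectors whose products make up the line element. In this basis the metric is block
    diagonal, with dU, dV spanning the only off-diagonal block, so it is a null coframe off the
    horizons too. *)
Definition coframe p : 'M[R]_5 := \matrix_i
  nth 0 [:: dx R ix0; dx R ix1; dx R ix2;
    W (p 0 ix0 * p 0 ix1) *: (p 0 ix0 *: dx R ix1 - p 0 ix1 *: dx R ix0)
      - sin (p 0 ix2) ^+ 2 *: dx R ix3 - cos (p 0 ix2) ^+ 2 *: dx R ix4;
    dx R ix3 - dx R ix4] i.

Definition coframe_gram p : 'M[R]_5 :=
  let x := p 0 ix0 * p 0 ix1 in \matrix_(i, j)
  nth 0 (nth [::] [:: [:: 0; F x; 0; 0; 0]; [:: F x; 0; 0; 0; 0];
    [:: 0; 0; M x; 0; 0]; [:: 0; 0; 0; N x; 0];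
    [:: 0; 0; 0; 0; M x * sin (p 0 ix2) ^+ 2 * cos (p 0 ix2) ^+ 2]] i) j.

Definition coframe_cogram p : 'M[R]_5 :=
  let x := p 0 ix0 * p 0 ix1 in \matrix_(i, j)
  nth 0 (nth [::] [:: [:: 0; (F x)^-1; 0; 0; 0]; [:: (F x)^-1; 0; 0; 0; 0];
    [:: 0; 0; (M x)^-1; 0; 0]; [:: 0; 0; 0; (N x)^-1; 0];
    [:: 0; 0; 0; 0; (M x * sin (p 0 ix2) ^+ 2 * cos (p 0 ix2) ^+ 2)^-1]] i) j.

(** The inverse of [coframe], with the dual vectors as columns; for instance column 0 is d/dU - W V
    (d/dphi + d/dpsi). *)
Definition dual_frame p : 'M[R]_5 :=
  let U := p 0 ix0 in let V := p 0 ix1 in let w := W (U * V) in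
  \matrix_(a, j)
  nth 0 (nth [::] [:: [:: 1; 0; 0; 0; 0]; [:: 0; 1; 0; 0; 0];
    [:: 0; 0; 1; 0; 0];
    [:: - (w * V); w * U; 0; -1; cos (p 0 ix2) ^+ 2];
    [:: - (w * V); w * U; 0; -1; - sin (p 0 ix2) ^+ 2]] a) j.

Lemma ord5_ind (P : 'I_5 -> Prop) :
  P ix0 -> P ix1 -> P ix2 -> P ix3 -> P ix4 -> forall i, P i.
Proof.
move=> P0 P1 P2 P3 P4 [[|[|[|[|[|//]]]]] i5];
  [move: P0|move: P1|move: P2|move: P3|move: P4];
  by congr P; apply: val_inj.
Qed.

Lemma sum5E (f : 'I_5 -> R) :
  \sum_i f i = f ix0 + f ix1 + f ix2 + f ix3 + f ix4.
Proof.
rewrite !big_ord_recl big_ord0 addr0 !addrA.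
by do ![congr (_ + _)|congr f; apply: val_inj].
Qed.

Lemma mul_coframe_dual p : coframe p *m dual_frame p = 1%:M.
Proof.
have sc : sin (p 0 ix2) ^+ 2 = 1 - cos (p 0 ix2) ^+ 2.
  by rewrite -(cos2Dsin2 (p 0 ix2)); ring.
apply/matrixP => i j; rewrite mxE sum5E.
by move: i j; apply: ord5_ind; apply: ord5_ind; rewrite !mxE /= ?mxE /= ?sc; ring.
Qed.

Lemma kruskal_metricE p : kruskal_metric F N M W p =
  (coframe p)^T *m coframe_gram p *m coframe p.
Proof.
apply/matrixP => i j; rewrite [RHS]mxE sum5E.
do 5 (rewrite [((coframe p)^T *m _) i _]mxE sum5E).
rewrite /kruskal_metric.
set x := p 0 ix0 * p 0 ix1; rewrite ![coframe_gram _ _ _]mxE /= ![_^T i _]mxE.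
rewrite ![coframe _ _ _]mxE /=; rewrite /ssq /sprod.
set e3 := W x *: _ - _ - _; set e4 := dx R ix3 - dx R ix4.
set c := sin _ ^+ 2 ; set c' := cos _ ^+ 2.
have aE (A B : 'M[R]_5) : (A + B) i j = A i j + B i j by rewrite mxE.
have zE k (A : 'M[R]_5) : (k *: A) i j = k * A i j by rewrite mxE.
have mE (a b : 'rV[R]_5) : (a^T *m b) i j = a 0 i * b 0 j.
  by rewrite mxE big_ord1 mxE.
by rewrite !(aE, zE, mE); field.
Qed.

Lemma kruskal_entry p i j : let x := p 0 ix0 * p 0 ix1 in
  let e := coframe p in
  kruskal_metric F N M W p i j =
  F x * (e ix0 i * e ix1 j + e ix1 i * e ix0 j) + M x * (e ix2 i * e ix2 j)
  + N x * (e ix3 i * e ix3 j)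
  + M x * sin (p 0 ix2) ^+ 2 * cos (p 0 ix2) ^+ 2 * (e ix4 i * e ix4 j).
Proof.
move=> x e; rewrite kruskal_metricE [LHS]mxE sum5E.
do 5 (rewrite [((coframe p)^T *m _) i _]mxE sum5E).
by rewrite ![coframe_gram _ _ _]mxE /= ![_^T i _]mxE -/x -/e; ring.
Qed.

Lemma coframe_gramV p : let x := p 0 ix0 * p 0 ix1 in
  F x != 0 -> M x != 0 -> N x != 0 -> sin (p 0 ix2) != 0 -> cos (p 0 ix2) != 0 ->
  coframe_gram p *m coframe_cogram p = 1%:M.
Proof.
move=> x F0 M0 N0 s0 c0.
apply/matrixP => i j; rewrite mxE sum5E.
by move: i j; apply: ord5_ind; apply: ord5_ind; rewrite !mxE /= -/x; field;
  rewrite ?F0 ?M0 ?N0 ?s0 ?c0.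
Qed.

Section Inverse.
Variable p : 'rV[R]_5.
Let x := p 0 ix0 * p 0 ix1.
Hypotheses (F0 : F x != 0) (M0 : 0 < M x) (N0 : 0 < N x).
Hypothesis (p_theta : 0 < p 0 ix2 < pi / 2).
Let g := kruskal_metric F N M W p.

Lemma sin_theta_gt0 : 0 < sin (p 0 ix2).
Proof. by apply: sin_gt0_pi; have := pi_gt0 R; move: p_theta; lra. Qed.

Lemma cos_theta_gt0 : 0 < cos (p 0 ix2).
Proof. by apply: cos_gt0_pihalf; have := pi_gt0 R; move: p_theta; lra. Qed.

Lemma mul_kruskal_inv : g *m (dual_frame p *m coframe_cogram p *m (dual_frame p)^T) = 1%:M.
Proof.
have s0 := lt0r_neq0 sin_theta_gt0; have c0 := lt0r_neq0 cos_theta_gt0.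
have M0' := lt0r_neq0 M0; have N0' := lt0r_neq0 N0.
rewrite /g kruskal_metricE !mulmxA -(mulmxA _ (coframe p)) mul_coframe_dual mulmx1.
rewrite -(mulmxA _ (coframe_gram p)) coframe_gramV // mulmx1.
by rewrite -trmx_mul (mulmx1C (mul_coframe_dual p)) trmx1.
Qed.

Lemma kruskal_unit : g \in unitmx.
Proof. by have [] := mulmx1_unit mul_kruskal_inv. Qed.

Lemma kruskal_sym : g^T = g.
Proof.
rewrite /g kruskal_metricE !trmx_mul trmxK mulmxA; congr (_ *m _ *m _).
by apply/matrixP; apply: ord5_ind; apply: ord5_ind; rewrite !mxE.
Qed.

Lemma coframe_codot i j :
  codot g (row i (coframe p)) (row j (coframe p)) = coframe_cogram p i j.
Proof.
rewrite codot_row; congr (fun_of_matrix _ i j).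
have -> : invmx g = dual_frame p *m coframe_cogram p *m (dual_frame p)^T.
  by rewrite -[invmx g]mulmx1 -mul_kruskal_inv mulKmx // kruskal_unit.
rewrite !mulmxA mul_coframe_dual mul1mx -mulmxA -trmx_mul mul_coframe_dual.
by rewrite trmx1 mulmx1.
Qed.

Lemma null_frame_coframe : null_frame g (coframe p).
Proof.
have s0 := sin_theta_gt0; have c0 := cos_theta_gt0; have F0' := F0.
split.
- by have [] := mulmx1_unit (mul_coframe_dual p).
- by rewrite !coframe_codot !mxE.
- by rewrite coframe_codot !mxE /= invr_eq0.
- apply: ord5_ind => // _; rewrite !coframe_codot !mxE /=; split=> //.
  + by rewrite invr_gt0.
  + by rewrite invr_gt0.
  + by rewrite invr_gt0 !mulr_gt0 ?exprn_gt0.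
Qed.

End Inverse.
End Frame.

Lemma row0_xrow (R : realType) n (E : 'M[R]_n.+2) :
  row 0 (xrow 0 1 E) = row 1 E.
Proof. by apply/rowP => j; rewrite !mxE tpermL. Qed.

(** At V = 0 the covector dV must stand in row 0, so the two null rows trade places. *)
Lemma null_frame_swap (R : realType) n (G E : 'M[R]_n.+2) : G^T = G ->
  null_frame G E -> null_frame G (xrow 0 1 E).
Proof.
move=> Gsym [Eu [E00 E11] E01 Em].
have r0 := row0_xrow E.
have r1 : row 1 (xrow 0 1 E) = row 0 E by apply/rowP => j; rewrite !mxE tpermR.
have rm (i : 'I_n.+2) : (1 < i)%N -> row i (xrow 0 1 E) = row i E.
  by move=> i1; apply/rowP => j; rewrite !mxE tpermD //; apply/eqP => ij; rewrite -ij in i1.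
split; rewrite ?r0 ?r1 //.
- by rewrite xrowE unitmx_mul Eu andbT unitmx_perm.
- by rewrite codotC.
- by move=> i i1; rewrite rm //; have [] := Em i i1.
Qed.

(** * Boost weights on the horizons *)

(** This reads orthogonality to dU as the absence of a U component in the raised vector. *)
Lemma codot_dx (R : realType) (G E : 'M[R]_5) i j :
  codot G (row i E) (dx R j) = (E *m invmx G) i j.
Proof. by rewrite /codot -row_mul /dx trmx_delta -colE !mxE. Qed.

Lemma is_derive_coord (R : realType) n (i : 'I_n) (q v : 'rV[R]_n) :
  is_derive q v (fun x => x 0 i) (v 0 i).
Proof.
apply: DeriveDef; first exact/diff_derivable/differentiable_coord.
have /matrixP/(_ 0 i) := @derive_mx R _ _ _ id q v (@derivable_id R _ q v).
by rewrite mxE derive_id.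
Qed.

Lemma ndiff_coord (R : realType) n (A : set 'rV[R]_n) k (i : 'I_n) :
  open A -> ndiff A k (fun p => p 0 i).
Proof.
move=> Ao; case: k => [//|k]; split=> [p _|v]; first exact: differentiable_coord.
apply: (eq_ndiff Ao _ (ndiff_cst Ao k (v 0 i))) => p _.
exact/esym/(@derive_val _ _ _ _ _ _ _ (is_derive_coord i p v)).
Qed.

(** U and V are restricted only through their product, so boosts preserve this set, and a point of a
    horizon stays in it all the way to the bifurcation sphere. *)
Definition horizon_domain (R : realType) (eps : R) : set 'rV[R]_5 :=
  [set p | `|p 0 ix0 * p 0 ix1| < eps /\ 0 < p 0 ix2 < pi / 2].

Section Horizon.
Context (R : realType) (eps : R) (F N M W : R -> R).
Implicit Types (p : 'rV[R]_5) (w : 'I_5 -> int).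
Let D := horizon_domain eps.
Let g := kruskal_metric F N M W.
Hypothesis kd : kruskal_data eps F N M W.
Hypothesis F0 : forall x, `|x| < eps -> F x != 0.

Lemma open_horizon_domain : open D.
Proof.
have c i : continuous (fun p : 'rV[R]_5 => p 0 i) by exact: coord_continuous.
have -> : D = ((fun p => `|p 0 ix0 * p 0 ix1|) @^-1` [set x | x < eps]) `&`
    (((fun p => p 0 ix2) @^-1` [set x | 0 < x]) `&`
     ((fun p => p 0 ix2) @^-1` [set x | x < pi / 2])).
  apply/seteqP; split=> p; rewrite /D /horizon_domain /=.
    by case=> ? /andP[].
  by case=> ? [-> ->].
apply: openI; last apply: openI.
- apply: open_comp; last exact: open_lt.
  move=> p _; apply: (@continuous_comp _ _ _ (fun p : 'rV[R]_5 => p 0 ix0 * p 0 ix1)).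
    exact: (cvgM (c ix0 p) (c ix1 p)).
  exact: norm_continuous.
- by apply: open_comp; [move=> p _; exact: (c ix2 p)|exact: open_gt].
- by apply: open_comp; [move=> p _; exact: (c ix2 p)|exact: open_lt].
Qed.
Let Dopen := open_horizon_domain.

Lemma ndiff_kruskal k i j : ndiff D k (fun p => g p i j).
Proof.
have kc i' : ndiff D k (fun p => p 0 i') by exact: ndiff_coord.
have kx f : smooth_near 0 eps f -> ndiff D k (fun p => f (p 0 ix0 * p 0 ix1)).
  move=> /smooth_nearP sf; apply: (ndiff_comp1 Dopen _ (sf k)); last exact: ndiffM.
  by move=> p [] /=; rewrite subr0.
have [ks kcos] : ndiff D k (fun p => sin (p 0 ix2)) /\ ndiff D k (fun p => cos (p 0 ix2)).
  by split; apply: (@ndiff_comp1 _ _ _ Dopen _ setT) => //;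
  have [] := smooth_sin_cos (@openT R).
have kE a b : ndiff D k (fun p => coframe W p a b).
  move: a; apply: ord5_ind.
    - by apply: (eq_ndiff Dopen _ (ndiff_cst Dopen k (dx R ix0 0 b))) => p _; rewrite !mxE.
    - by apply: (eq_ndiff Dopen _ (ndiff_cst Dopen k (dx R ix1 0 b))) => p _; rewrite !mxE.
    - by apply: (eq_ndiff Dopen _ (ndiff_cst Dopen k (dx R ix2 0 b))) => p _; rewrite !mxE.
    - apply: (@eq_ndiff _ _ _ Dopen _ (fun p => W (p 0 ix0 * p 0 ix1) *
          (p 0 ix0 * dx R ix1 0 b - p 0 ix1 * dx R ix0 0 b) -
          sin (p 0 ix2) ^+ 2 * dx R ix3 0 b - cos (p 0 ix2) ^+ 2 * dx R ix4 0 b)).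
        by move=> p _; rewrite !mxE.
      have kc' (f : 'rV[R]_5 -> R) c : ndiff D k f -> ndiff D k (fun p => f p * c).
        by move=> kf; apply: ndiffM => //; apply: ndiff_cst.
      by apply: ndiffB => //; [apply: ndiffB => //; [apply: ndiffM => //;
        [exact/kx/(kruskal_smoothW kd)|apply: ndiffB => //]|]|]; apply: kc' => //; apply: ndiffX.
    - by apply: (eq_ndiff Dopen _ (ndiff_cst Dopen k ((dx R ix3 - dx R ix4) 0 b)))
        => p _; rewrite [in RHS]mxE.
have kF := kx _ (kruskal_smoothF kd); have kN := kx _ (kruskal_smoothN kd).
have kM := kx _ (kruskal_smoothM kd).
apply: (eq_ndiff Dopen (fun p _ => esym (kruskal_entry F N M W p i j))).
have kEE a b : ndiff D k (fun p => coframe W p a i * coframe W p b j).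
  exact: ndiffM.
apply: ndiffD => //; last first.
  by do 3![apply: ndiffM => //]; apply: ndiffX.
by apply: ndiffD => //; [apply: ndiffD => //|]; apply: ndiffM => //; apply: ndiffD.
Qed.

Lemma kruskal_dilate (b : 'I_5 -> R) p i j :
  b ix0 * b ix1 = 1 -> b ix2 = 1 -> b ix3 = 1 -> b ix4 = 1 ->
  g p i j = b i * b j * g (dilate b p) i j.
Proof.
move=> b01 b2 b3 b4; have b10 : b ix1 * b ix0 = 1 by rewrite mulrC.
have xE : dilate b p 0 ix0 * dilate b p 0 ix1 = p 0 ix0 * p 0 ix1.
  by rewrite !mxE -[RHS]mul1r -b01; ring.
have tE : dilate b p 0 ix2 = p 0 ix2 by rewrite mxE b2 mul1r.
(* [c k] undoes the factor picked up by row [k] of the coframe. The factors of dU and dV are inverse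
   to each other; the remaining rows are invariant, since U dV - V dU is. *)
pose c (k : 'I_5) := if k == ix0 then b ix1 else if k == ix1 then b ix0 else 1.
have eE k l : coframe W p k l = b l * c k * coframe W (dilate b p) k l.
  move: k l; do 2![apply: ord5_ind];
    rewrite /c ![coframe _ _ _ _]mxE /= ?xE ?tE !mxE /=
      ?(mulr1, mul1r, mulr0, mul0r, subr0, sub0r, b01, b10, b2, b3, b4, oppr0) //; try ring.
  - rewrite -[LHS]mul1r -b01; ring.
  - rewrite -[LHS]mul1r -b01; ring.
rewrite /g !kruskal_entry xE tE !(eE _ i) !(eE _ j) /c /=.
set F' := F _; set M' := M _; set N' := N _; set E := coframe W (dilate b p).
transitivity (b i * b j * (b ix0 * b ix1 * (F' * (E ix0 i * E ix1 j + E ix1 i * E ix0 j))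
  + M' * (E ix2 i * E ix2 j) + N' * (E ix3 i * E ix3 j)
  + M' * sin (p 0 ix2) ^+ 2 * cos (p 0 ix2) ^+ 2 * (E ix4 i * E ix4 j))); first ring.
by rewrite b01 mul1r.
Qed.

Section TensorField.
Variable T : 'rV[R]_5 -> tensor4 R 5.
Hypothesis T_continuous :
  forall p a b c d, D p -> {for p, continuous (fun q => T q a b c d)}.
Hypothesis T_dilate : forall (b : 'I_5 -> R), (forall i, b i != 0) ->
  b ix0 * b ix1 = 1 -> b ix2 = 1 -> b ix3 = 1 -> b ix4 = 1 ->
  forall p, D p -> forall i j k l, T p i j k l = b i * b j * b k * b l * T (dilate b p) i j k l.

(* For e = 1 (resp. -1) the boosts move a point of U = 0 (resp. V = 0) towards
   the bifurcation sphere, where T stays bounded by continuity, while they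
   multiply a component of negative weight by an unbounded factor. *)
Lemma horizon_weight (e : int) p a b c d :
  let w i := e * @boost_weight1 3 i in
  e = 1 \/ e = -1 -> D p -> (forall i, w i = 1 -> p 0 i = 0) ->
  T p a b c d != 0 -> 0 <= w a + w b + w c + w d.
Proof.
move=> w e1 Dp p0; apply: contraNle => wlt0; apply/eqP.
(* The boost itself multiplies the coordinate of weight 1 by the inverse of [s]. That coordinate is
   0 at [p], so the factor 1 gives the same point, and the path extends continuously to [s = 0],
   where it reaches the bifurcation sphere. *)
pose f (s : R) : 'I_5 -> R := fun i => if w i == -1 then s else 1.
have w2 (i : 'I_5) : (1 < i)%N -> w i = 0.
  by move: i; apply: ord5_ind => // _; rewrite /w mulr0.
have w0 : w ix0 = e by rewrite /w mulr1.
have w1 : w ix1 = - e by rewrite /w mulrN1.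
have UV0 : p 0 ix0 * p 0 ix1 = 0.
  by case: e1 => eE; [rewrite p0 ?w0 ?mul0r|rewrite (p0 ix1) ?mulr0 // w1 eE].
have Dc s : D (dilate (f s) p).
  split; last by rewrite mxE /f w2 // mul1r; case: Dp.
  by rewrite !mxE mulrACA UV0 mulr0 normr0; apply: kruskal_eps kd.
have [m wE] : exists m : nat, w a + w b + w c + w d = - m.+1%:Z.
  by exists (absz (w a + w b + w c + w d)).-1; lia.
apply: (@scaled_limit_eq0 _ _ (fun s => T (dilate (f s) p) a b c d) m).
  move=> s s0; pose B i := s ^ (- w i).
  have B0 i : B i != 0 by apply: expfz_neq0.
  have B01 : B ix0 * B ix1 = 1 by rewrite /B w0 w1 -expfzDr // opprK addNr.
  have B2 (i : 'I_5) : (1 < i)%N -> B i = 1 by move=> i1; rewrite /B w2 // oppr0.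
  rewrite (T_dilate B0 B01 (B2 ix2 isT) (B2 ix3 isT) (B2 ix4 isT) Dp a b c d) /B.
  rewrite -!expfzDr // -!opprD wE opprK; congr (_ * T _ _ _ _ _).
  apply/rowP => i; rewrite !mxE /f; case: eqP => [->|wN1]; first by rewrite opprK expr1z.
  have [w1i|w1i] := eqVneq (w i) 1; first by rewrite p0 ?mulr0.
  suff -> : w i = 0 by rewrite oppr0 expr0z.
  move: i wN1 w1i; apply: ord5_ind; try by move=> _ _; apply: w2.
    by rewrite w0; case: e1 => ->.
  by rewrite w1; case: e1 => ->; rewrite ?opprK.
have -> : (fun s => T (dilate (f s) p) a b c d) =
  (fun q => T q a b c d) \o (fun s => dilate (f s) p) by [].
apply: continuous_comp; last exact: T_continuous.
apply: differentiable_continuous; apply: differentiable_rV => i.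
rewrite (_ : (fun s => _) = (fun s => f s i * p 0 i)); last first.
  by apply/funext => s; rewrite mxE.
by apply: differentiableM => //; rewrite /f; case: (w i == -1).
Qed.

Section Point.
Variable p : 'rV[R]_5.
Hypothesis p_theta : 0 < p 0 ix2 < pi / 2.
Hypothesis UV0 : p 0 ix0 * p 0 ix1 = 0.
Let Fp : F (p 0 ix0 * p 0 ix1) != 0.
Proof. by rewrite UV0 F0 // normr0; apply: kruskal_eps kd. Qed.
Let Mp : 0 < M (p 0 ix0 * p 0 ix1).
Proof. by rewrite UV0 (kruskal_M_gt0 kd) // normr0; apply: kruskal_eps kd. Qed.
Let Np : 0 < N (p 0 ix0 * p 0 ix1).
Proof. by rewrite UV0 (kruskal_N_gt0 kd) // normr0; apply: kruskal_eps kd. Qed.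
Let Dp : D p.
Proof. by split=> //=; rewrite UV0 normr0; apply: kruskal_eps kd. Qed.
Let gu : g p \in unitmx := kruskal_unit W Fp Mp Np p_theta.
Let gsym : (g p)^T = g p := kruskal_sym F N M W p.
Let nf : null_frame (g p) (coframe W p) := null_frame_coframe W Fp Mp Np p_theta.

Lemma row0_coframe : row 0 (coframe W p) = dx R ix0.
Proof. by apply/rowP => j; rewrite !mxE. Qed.

Lemma row1_coframe : row 1 (coframe W p) = dx R ix1.
Proof. by apply/rowP => j; rewrite !mxE. Qed.

(** Lowering d/dV gives F dU plus N W U times the fourth coframe covector, and the second term dies
    on U = 0. *)
Lemma dU_raise : p 0 ix0 = 0 ->
  dx R ix0 *m invmx (g p) = (F (p 0 ix0 * p 0 ix1))^-1 *: dx R ix1.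
Proof.
move=> U0; have e : dx R ix1 *m g p = F (p 0 ix0 * p 0 ix1) *: dx R ix0.
  rewrite -rowE; apply/rowP => j; rewrite mxE /g kruskal_entry.
  by move: j; apply: ord5_ind; rewrite !mxE /= U0; ring.
by rewrite -[dx R ix0 in LHS](scalerK Fp) -e -scalemxAl mulmxK.
Qed.

Lemma dV_raise : p 0 ix1 = 0 ->
  dx R ix1 *m invmx (g p) = (F (p 0 ix0 * p 0 ix1))^-1 *: dx R ix0.
Proof.
move=> V0; have e : dx R ix0 *m g p = F (p 0 ix0 * p 0 ix1) *: dx R ix1.
  rewrite -rowE; apply/rowP => j; rewrite mxE /g kruskal_entry.
  by move: j; apply: ord5_ind; rewrite !mxE /= V0; ring.
by rewrite -[dx R ix1 in LHS](scalerK Fp) -e -scalemxAl mulmxK.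
Qed.

(* (z, o, e) is (U, V, 1) or (V, U, -1): at z = 0 the vector dual to dz is along
   the coordinate o, so that every frame vector but n has no component along z. *)
Lemma frame_component_horizon (z o : 'I_5) (e : int) (c : R) E i j k l :
  (forall a, e * @boost_weight1 3 a = (a == z)%:R - (a == o)%:R) ->
  z != o -> e = 1 \/ e = -1 -> p 0 z = 0 ->
  dx R z *m invmx (g p) = c *: dx R o ->
  null_frame (g p) E -> row 0 E = dx R z ->
  0 < boost_weight i j k l -> frame_component (g p) (T p) E i j k l = 0.
Proof.
move=> eE z_o e1 z0 zo [_ _ _ Em] E0.
apply: (@frame_component_eq0 _ _ _ _ _ _ (fun a => e * @boost_weight1 3 a)).
  move=> a b c' d; apply: horizon_weight => // y.
  by rewrite eE; case: eqVneq => [-> //|_]; case: (y == o).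
move=> y a; rewrite eE /boost_weight1; have [->|y0] := eqVneq y 0.
  have -> : (E *m invmx (g p)) 0 a = (c *: dx R o) 0 a.
    by rewrite -zo -E0 -row_mul [RHS]mxE.
  rewrite !mxE eqxx /=; have [->|_] := eqVneq a o; last by rewrite mulr0 eqxx.
  by rewrite (eq_sym o) (negPf z_o).
have [->|y1] := eqVneq y 1; first by case: (a == z); case: (a == o).
have [->|_ _] := eqVneq a z; last by case: (a == o).
have {}y1 : (1 < y)%N by move: y y0 y1 => [[|[|]]].
have -> : (E *m invmx (g p)) y z = codot (g p) (row y E) (row 0 E).
  by rewrite E0 codot_dx.
by rewrite codotC //; have [_ -> _] := Em y y1; rewrite eqxx.
Qed.

Lemma dx_neq0 i : dx R i != 0.
Proof. by apply/eqP => /rowP/(_ i)/eqP; rewrite !mxE !eqxx oner_eq0. Qed.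

Lemma multiple_aligned_dU : p 0 ix0 = 0 -> multiple_aligned (g p) (T p) (dx R ix0).
Proof.
move=> U0; have [_ [nU _] _ _] := nf; split.
- by split; [exact: dx_neq0|rewrite -row0_coframe].
- by exists (coframe W p); split; [exact: nf|exact: row0_coframe].
- move=> E nE E0 i j k l; apply: (@frame_component_horizon ix0 ix1 1 _ E) => //.
  + by apply: ord5_ind.
  + by left.
  + exact: dU_raise.
Qed.

Lemma multiple_aligned_dV : p 0 ix1 = 0 -> multiple_aligned (g p) (T p) (dx R ix1).
Proof.
move=> V0; have [_ [_ nV] _ _] := nf; split.
- by split; [exact: dx_neq0|rewrite -row1_coframe].
- exists (xrow 0 1 (coframe W p)); split; first exact: null_frame_swap gsym nf.
  by rewrite row0_xrow row1_coframe.
- move=> E nE E0 i j k l; apply: (@frame_component_horizon ix1 ix0 (-1) _ E) => //.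
  + by apply: ord5_ind.
  + by right.
  + exact: dV_raise.
Qed.

Lemma typeD_bifurcation : p 0 ix0 = 0 -> p 0 ix1 = 0 -> typeD (g p) (T p).
Proof.
move=> U0 V0; exists (coframe W p); split; first exact: nf.
move=> i j k l; rewrite neq_lt => /orP[]; last first.
  by case: (multiple_aligned_dU U0) => _ _; apply; [exact: nf|exact: row0_coframe].
(* Negative weights follow from the horizon V = 0 with both weight functions negated. The frame is
   kept as it is, whereas [multiple_aligned_dV] speaks of frames whose first row is dV. *)
move=> bw; apply: (@frame_component_eq0 _ _ _ _ _ (fun a => - @boost_weight1 3 a)
    (fun a => -1 * @boost_weight1 3 a)); last first.
  by move: bw; rewrite /boost_weight; lia.
  move=> y a; rewrite mulN1r opprK; have [_ _ _ nm] := nf.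
  have X1 b : (coframe W p *m invmx (g p)) 1 b =
      ((F (p 0 ix0 * p 0 ix1))^-1 *: dx R ix0) 0 b.
    by rewrite -dV_raise // -row1_coframe -row_mul [RHS]mxE.
  have [->|y1] := eqVneq y 1.
    rewrite X1 !mxE eqxx /=; have [->|_] // := eqVneq a ix0.
    by rewrite mulr0 eqxx.
  rewrite /boost_weight1 (negPf y1); case: (a == 0); first by case: (y == 0).
  have [->|_] := eqVneq a 1; last by case: (y == 0).
  have [-> //|y0] := eqVneq y 0.
  have {}y1 : (1 < y)%N by move: y y0 y1 => [[|[|]]].
  have -> : (coframe W p *m invmx (g p)) y 1 =
      codot (g p) (row y (coframe W p)) (row 1 (coframe W p)).
    by rewrite row1_coframe codot_dx; congr (fun_of_matrix _ y _); apply: val_inj.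
  by rewrite codotC //; have [_ _ ->] := nm y y1; rewrite eqxx.
move=> a b c d; apply: horizon_weight => //; first by right.
by apply: ord5_ind.
Qed.
End Point.

(** Continuity and boost homogeneity are all that is asked of [T], so the Weyl and Riemann tensors
    are handled by one argument. *)
Lemma horizon_types_boost_invariant : horizon_types g T.
Proof.
move=> p p_theta; split.
- by move=> U0; apply: multiple_aligned_dU; rewrite ?U0 ?mul0r.
- by move=> V0; apply: multiple_aligned_dV; rewrite ?V0 ?mulr0.
- case=> [U0|V0]; [exists (dx R ix0)|exists (dx R ix1)].
    by apply: multiple_aligned_dU; rewrite ?U0 ?mul0r.
  by apply: multiple_aligned_dV; rewrite ?V0 ?mulr0.
- by case=> U0 V0; apply: typeD_bifurcation; rewrite ?U0 ?mul0r.
Qed.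

End TensorField.

Lemma horizon_types_nonvanishing :
  horizon_types g (weyl g) /\ horizon_types g (riemann g).
Proof.
have gu p : D p -> g p \in unitmx.
  case=> xe pt; rewrite -[_ * _]subr0 in xe.
  apply: kruskal_unit => //; first by apply: F0; rewrite subr0 in xe.
    by apply: (kruskal_M_gt0 kd); rewrite subr0 in xe.
  by apply: (kruskal_N_gt0 kd); rewrite subr0 in xe.
have Ddil (b : 'I_5 -> R) : b ix0 * b ix1 = 1 -> b ix2 = 1 ->
    forall p, D p -> D (dilate b p).
  by move=> b01 b2 p [xe pt]; split; rewrite !mxE ?b2 ?mul1r // mulrACA b01 mul1r.
split; apply: horizon_types_boost_invariant.
- move=> p a b c d Dp; apply: ndiff_continuous Dp.
  by apply: ndiff_weyl => // i j; apply: ndiff_kruskal.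
- move=> b b0 b01 b2 b3 b4 p Dp i j k l; apply: (weyl_dilate b0 Dopen) Dp => //.
  + exact: Ddil.
  + by move=> ? ?; apply: ndiff_kruskal.
  + by move=> q x y; apply: kruskal_dilate.
- move=> p a b c d Dp; apply: ndiff_continuous Dp.
  by apply: ndiff_riemann => // i j; apply: ndiff_kruskal.
- move=> b b0 b01 b2 b3 b4 p Dp i j k l; apply: (riemann_dilate b0 Dopen) Dp => //.
  + exact: Ddil.
  + by move=> ? ?; apply: ndiff_kruskal.
  + by move=> q x y; apply: kruskal_dilate.
Qed.

End Horizon.

(** * Shrinking the neighbourhood of the horizon *)

Lemma near_ball (R : realType) (P : R -> Prop) (c : R) :
  (\forall x \near c, P x) -> exists2 e, 0 < e & forall x, `|x - c| < e -> P x.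
Proof.
move=> /nbhs_ballP[e e0 eP]; exists e => // x xc; apply: eP.
by rewrite -ball_normE /ball_ /= distrC.
Qed.

Lemma smooth_near_continuous (R : realType) (c eps : R) f x :
  smooth_near c eps f -> `|x - c| < eps -> {for x, continuous f}.
Proof.
by move=> sf xc; apply/differentiable_continuous/derivable1_diffP; apply: (sf 0).
Qed.

Lemma smooth_near_sub (R : realType) (c e e' : R) f :
  e' <= e -> smooth_near c e f -> smooth_near c e' f.
Proof. by move=> ee sf k x xc; apply: sf; apply: lt_le_trans ee. Qed.

Lemma smooth_near_neq0 (R : realType) (c eps : R) f : 0 < eps ->
  smooth_near c eps f -> f c != 0 ->
  exists2 e, 0 < e <= eps & forall x, `|x - c| < e -> f x != 0.
Proof.
move=> eps0 sf fc0; have fc : {for c, continuous f}.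
  by apply: smooth_near_continuous sf _; rewrite subrr normr0.
have /near_ball[e e0 eP] : \forall x \near c, f x != 0 by exact: cvgr_neq0 fc fc0.
exists (Num.min e eps); first by rewrite lt_min e0 eps0 ge_min lexx orbT.
by move=> x; rewrite lt_min => /andP[/eP].
Qed.

Lemma kruskal_data_sub (R : realType) (e e' : R) (F N M W : R -> R) :
  0 < e' <= e -> kruskal_data e F N M W -> kruskal_data e' F N M W.
Proof.
move=> /andP[e0 ee] [_ sF sN sM sW F0 W0 N0 M0]; split=> //.
- exact: smooth_near_sub sF.
- exact: smooth_near_sub sN.
- exact: smooth_near_sub sM.
- exact: smooth_near_sub sW.
- by move=> x xe; apply/N0/(lt_le_trans xe).
- by move=> x xe; apply/M0/(lt_le_trans xe).
Qed.

(** By continuity [F] is non-zero on a smaller interval around 0. Passing to it loses nothing, since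
    the claims concern only points with U V = 0. *)
Theorem kruskal_horizon_types (R : realType) (eps : R) (F N M W : R -> R) :
  kruskal_data eps F N M W ->
  let g := kruskal_metric F N M W in
  horizon_types g (weyl g) /\ horizon_types g (riemann g).
Proof.
move=> kd; have [e ee Fe] := smooth_near_neq0 (kruskal_eps kd) (kruskal_smoothF kd) (kruskal_F0 kd).
apply: (horizon_types_nonvanishing (kruskal_data_sub ee kd)) => x xe.
by apply: Fe; rewrite subr0.
Qed.

(** * Hadamard quotients *)

Lemma is_derive_continuous (R : realType) (f : R -> R) (x l : R) :
  is_derive x 1 f l -> {for x, continuous f}.
Proof. by move=> df; apply/differentiable_continuous/derivable1_diffP. Qed.

Section Hadamard.
Context (R : realType) (c eps : R).
Hypothesis eps0 : 0 < eps.
Let B := [set x : R | `|x - c| < eps].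
Implicit Types (f g u v : R -> R) (k : nat).

Lemma open_dist_lt : open B.
Proof.
rewrite (_ : B = ball c eps); first exact: ball_open.
by apply/seteqP; split=> x /=; rewrite -ball_normE /= distrC.
Qed.

Lemma dist_self_lt : B c.
Proof. by rewrite /B /= subrr normr0. Qed.

Lemma continuous_extend (q : R -> R) (l : R) :
  q x @[x --> c^'] --> l -> {for c, continuous (fun x => if x == c then l else q x)}.
Proof.
move=> ql; rewrite /prop_for /continuous_at eqxx; apply/cvgrPdist_lt => e e0.
move/cvgrPdist_lt : ql => /(_ _ e0); rewrite near_withinE; apply: filterS => x xP.
by case: eqVneq => [_|xc]; [rewrite subrr normr0|apply: xP].
Qed.

Lemma lhopital_at (f df g dg : R -> R) (l : R) :
  (forall x, B x -> x != c -> is_derive x 1 f (df x)) ->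
  (forall x, B x -> x != c -> is_derive x 1 g (dg x)) ->
  (forall x, B x -> x != c -> dg x != 0) ->
  f x @[x --> c] --> (0 : R) -> g x @[x --> c] --> (0 : R) ->
  df x / dg x @[x --> c^'] --> l -> f x / g x @[x --> c^'] --> l.
Proof.
move=> fdf gdg dg0 f0 g0 dfg.
(* Resetting both derivatives at [c] makes their quotient equal to [l] there, which turns the
   punctured limit into an ordinary one. *)
pose df' x := if x == c then l else df x; pose dg' x := if x == c then 1 else dg x.
have inB x : x \in `]c - eps, c + eps[ `\ c -> B x /\ x != c.
  rewrite inE => -[/=]; rewrite in_itv /= => /andP[x1 x2] /eqP xc; split=> //.
  by rewrite /B /= ltr_distl x1 x2.
apply: (@lhopital R f df' g dg' (c - eps) (c + eps) c l) => //.
- by rewrite in_itv /= ltrBlDr ltrDl eps0.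
- by move=> x /inB[Bx xc]; rewrite /df' (negPf xc); apply: fdf.
- by move=> x /inB[Bx xc]; rewrite /dg' (negPf xc); apply: gdg.
- by move=> x /inB[Bx xc]; rewrite /dg' (negPf xc); apply: dg0.
have := continuous_extend dfg; rewrite /prop_for /continuous_at eqxx.
rewrite (_ : (fun x => if _ then _ else _) = (fun x => df' x / dg' x)) //.
by apply/funext => x; rewrite /df' /dg'; case: eqP => // _; rewrite divr1.
Qed.

Lemma is_derive_center_pow n (x : R) :
  is_derive x 1 (fun y => (y - c) ^+ n.+1) (n.+1%:R * (x - c) ^+ n).
Proof.
have -> : (fun y : R => (y - c) ^+ n.+1) = ((id - cst c) ^+ n.+1).
  by apply/funext => y; rewrite exprfctE.
apply: (is_derive_eq (is_deriveX _ (is_deriveB (is_derive_id _ _) (is_derive_cst _ _ _)))).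
by rewrite /GRing.scale /= subr0 mulr1.
Qed.

Lemma dnbhs_lim (f : R -> R) (l : R) : f x @[x --> c] --> l -> f x @[x --> c^'] --> l.
Proof. exact: cvg_within_filter. Qed.

Lemma near_punctured (P : R -> Prop) :
  (forall x, B x -> x != c -> P x) -> \forall x \near c^', P x.
Proof.
move=> BP; rewrite near_withinE; have : \forall x \near c, B x.
  by apply: open_nbhs_nbhs; split; [exact: open_dist_lt|exact: dist_self_lt].
by apply: filterS.
Qed.

(* Equation satisfied by u(x) = (x - c)^-(k+1) * int_c^x (t - c)^k g(t) dt. *)
Definition hadamard_eq k (g u : R -> R) :=
  [/\ {for c, continuous u}, u c = g c / k.+1%:R
    & forall x, B x -> x != c ->
      derivable u x 1 /\ (derive1 u) x * (x - c) + k.+1%:R * u x = g x ].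

(** Differentiating u' (x - c) + (k + 1) u = g gives u'' (x - c) + (k + 2) u' = g', the same
    equation one step up. The difficulty is the point [c]: L'Hôpital's rule gives first the limit of
    u' there, then that of the difference quotient of u. *)
Lemma hadamard_eq_derive1 k g u : smooth_near c eps g -> hadamard_eq k g u ->
  derivable u c 1 /\ hadamard_eq k.+1 (derive1 g) (derive1 u).
Proof.
move=> sg [uc ucE uE]; have kn0 n : n.+1%:R != 0 :> R by rewrite pnatr_eq0.
have gd x : B x -> is_derive x 1 g ((derive1 g) x).
  by move=> Bx; rewrite derive1E; apply: DeriveDef => //; apply: (sg 0).
have g'd x : B x -> is_derive x 1 (derive1 g) ((derive1 (derive1 g)) x).
  by move=> Bx; rewrite derive1E; apply: DeriveDef => //; apply: (sg 1).
have ud x : B x -> x != c -> is_derive x 1 u ((derive1 u) x).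
  by move=> Bx xc; rewrite derive1E; apply: DeriveDef => //; case: (uE x Bx xc).
have gc : {for c, continuous g} by apply: smooth_near_continuous sg dist_self_lt.
have g'c : {for c, continuous (derive1 g)}.
  by apply/differentiable_continuous/derivable1_diffP; apply: (sg 1 c dist_self_lt).
pose l := (derive1 g) c / k.+2%:R.
have v_lim : (derive1 u) x @[x --> c^'] --> l.
  (* Off [c] the quotient w / z is u'. The power of x - c is chosen so that the terms in u' cancel
     in w', leaving (x - c)^(k+1) g' with no second derivative of u. *)
  pose w x := (x - c) ^+ k.+1 * (g x - k.+1%:R * u x).
  pose dw x := (x - c) ^+ k.+1 * (derive1 g) x.
  pose z x := (x - c) ^+ k.+2; pose dz x := k.+2%:R * (x - c) ^+ k.+1.
  have : w x / z x @[x --> c^'] --> l.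
    apply: (@lhopital_at _ dw _ dz).
    - move=> x Bx xc; have dux := ud x Bx xc; have dgx := gd x Bx.
      have dw' := is_deriveM (is_derive_center_pow k x)
        (is_deriveB dgx (is_deriveZ k.+1%:R dux)).
      apply: (is_derive_eq dw'); have [_ gE] := uE x Bx xc.
      have -> : (g - k.+1%:R \*: u) x = derive1 u x * (x - c).
        by rewrite -[RHS](addrK (k.+1%:R * u x)) gE.
      by rewrite /GRing.scale /= /dw exprSr; ring.
    - by move=> x Bx xc; apply: is_derive_center_pow.
    - by move=> x Bx xc; rewrite mulf_neq0 // expf_neq0 // subr_eq0.
    - rewrite -[X in _ --> X](_ : w c = 0); last by rewrite /w subrr exprS !mul0r.
      apply: cvgM; first exact: is_derive_continuous (is_derive_center_pow k c).
      apply: cvgB; [exact: gc|apply: cvgM => //; exact: cvg_cst].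
    - rewrite -[X in _ --> X](_ : z c = 0); last by rewrite /z subrr exprS !mul0r.
      exact: is_derive_continuous (is_derive_center_pow k.+1 c).
    - apply: (@cvg_trans _ ((fun x => (derive1 g) x / k.+2%:R) @ c^')); last first.
        by apply: dnbhs_lim; apply: cvgM; [exact: g'c|exact: cvg_cst].
      apply: near_eq_cvg; apply: near_punctured => x Bx xc.
      have : (x - c) ^+ k.+1 != 0 by rewrite expf_neq0 // subr_eq0.
      rewrite /dw /dz; move: (kn0 k.+1); move: (k.+2%:R) => n n0; move: (_ ^+ _) => a a0.
      by field; rewrite ?a0 ?n0.
  apply: cvg_trans; apply: near_eq_cvg; apply: near_punctured => x Bx xc.
  have [_ gE] := uE x Bx xc; rewrite /w /z -gE addrK [_ ^+ k.+2]exprSr.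
  have a0 : (x - c) ^+ k.+1 != 0 by rewrite expf_neq0 // subr_eq0.
  have xc0 : x - c != 0 by rewrite subr_eq0.
  by move: a0; set a := _ ^+ _ => a0; field; rewrite a0 xc0.
have uc' : is_derive c 1 u l.
  apply/is_derive1_caratheodory.
  exists (fun x => if x == c then l else (u x - u c) / (x - c)); split.
  - by move=> x; case: eqVneq => [->|xc]; rewrite ?subrr ?mulr0 // divfK // subr_eq0.
  - apply: continuous_extend.
    apply: (@lhopital_at (fun x => u x - u c) (derive1 u) (fun x => x - c) (fun=> 1)).
    + move=> x Bx xc; apply: (is_derive_eq (is_deriveB (ud x Bx xc) (is_derive_cst _ _ _))).
      by rewrite subr0.
    + move=> x Bx xc; apply: (is_derive_eq (is_deriveB (is_derive_id _ _) (is_derive_cst _ _ _))).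
      by rewrite subr0.
    + by move=> x _ _; apply: oner_neq0.
    + by rewrite -(subrr (u c)); apply: cvgB; [exact: uc|exact: cvg_cst].
    + by rewrite -[X in _ --> X](subrr c); apply: cvgB; [exact: cvg_id|exact: cvg_cst].
    + by rewrite (_ : (fun x => _) = (derive1 u)) //; apply/funext => x; rewrite divr1.
  - by rewrite eqxx.
have u'c : (derive1 u) c = l by rewrite derive1E derive_val.
split; first by have [] := uc'.
split; [|exact: u'c|].
  rewrite (_ : (derive1 u) = fun x => if x == c then l else (derive1 u) x); last first.
    by apply/funext => x; case: eqP => // ->.
  exact: continuous_extend.
(* Off [c] the equation can be solved for u', which shows that u' is derivable there. *)
move=> x Bx xc; pose v y := (g y - k.+1%:R * u y) / (y - c).
have u'v : \forall y \near x, v y = (derive1 u) y.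
  have : \forall y \near x, B y /\ y != c.
    apply: filterI; first by apply: open_nbhs_nbhs; split => //; exact: open_dist_lt.
    by apply: open_nbhs_nbhs; split; [exact: (@open_neq R c)|].
  apply: filterS => y [By yc]; have [_ gE] := uE y By yc.
  by rewrite /v -gE addrK mulfK // subr_eq0.
have dv : derivable v x 1.
  apply: derivableM.
    apply: derivableB; first by have [] := gd x Bx.
    by apply: derivableZ; have [] := ud x Bx xc.
  apply: derivableV; first by rewrite subr_eq0.
  by have [] := is_deriveB (is_derive_id x 1) (is_derive_cst c x 1).
have du' : derivable (derive1 u) x 1 by apply: near_eq_derivable u'v dv.
split=> //.
have gE : \forall y \near x, (derive1 u) y * (y - c) + k.+1%:R * u y = g y.
  have : \forall y \near x, B y /\ y != c.
    apply: filterI; first by apply: open_nbhs_nbhs; split => //; exact: open_dist_lt.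
    by apply: open_nbhs_nbhs; split; [exact: (@open_neq R c)|].
  by apply: filterS => y [By yc]; have [_ ->] := uE y By yc.
have := @near_eq_derive R R R _ _ x 1 gE; rewrite -[in RHS]derive1E => <-.
have du2 : is_derive x 1 (derive1 u) ((derive1 (derive1 u)) x) by rewrite derive1E; apply: DeriveDef.
have e := is_deriveD (is_deriveM du2 (is_deriveB (is_derive_id x 1) (is_derive_cst c x 1)))
  (is_deriveZ k.+1%:R (ud x Bx xc)).
rewrite [RHS](@derive_val _ _ _ _ _ _ _ e) /GRing.scale /=.
by rewrite -[(id - cst c) x]/(x - c) -(natr1 k.+1); ring.
Qed.

Lemma ndiff_hadamard n k g u : smooth_near c eps g -> hadamard_eq k g u ->
  ndiff B n u.
Proof.
elim: n k g u => [//|n IH] k g u sg ug.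
have [du u'g] := hadamard_eq_derive1 sg ug; apply: ndiff_derive1; first exact: open_dist_lt.
  move=> x Bx; case: (eqVneq x c) => [->|xc] //.
  by have [_ _ uE] := ug; case: (uE x Bx xc).
apply: IH u'g; apply/smooth_nearP; apply: smooth_derive1.
exact/smooth_nearP.
Qed.

(** The Carathéodory quotient q is continuous at [c], and differentiating (x - c) q = f - f(c) gives
    [hadamard_eq] with k = 0 and right-hand side f'. Smoothness is then that of any solution. *)
Lemma hadamard f : smooth_near c eps f ->
  exists q, [/\ smooth_near c eps q, q c = derive1 f c
    & forall x, f x = f c + (x - c) * q x].
Proof.
move=> sf.
have fd x : B x -> is_derive x 1 f (derive1 f x).
  by move=> Bx; rewrite derive1E; apply: DeriveDef => //; apply: (sf 0).
have [q [qE qc qcE]] := (is_derive1_caratheodory _ _ _).1 (fd c dist_self_lt).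
exists q; split=> //; last by move=> x; rewrite mulrC -qE addrC subrK.
have sf' : smooth_near c eps (derive1 f).
  by apply/smooth_nearP/smooth_derive1/smooth_nearP.
apply/smooth_nearP => n; apply: (@ndiff_hadamard n 0 (derive1 f)) => //.
split=> [||x Bx xc]; [exact: qc|by rewrite qcE divr1|].
have qv : \forall y \near x, (f y - f c) / (y - c) = q y.
  have : \forall y \near x, y != c.
    by apply: open_nbhs_nbhs; split; [exact: (@open_neq R c)|].
  by apply: filterS => y yc; rewrite qE mulfK // subr_eq0.
have dc : is_derive x 1 (fun y => y - c) 1.
  by apply: (is_derive_eq (is_deriveB (is_derive_id x 1) (is_derive_cst c x 1)));
    rewrite subr0.
have dq : derivable q x 1.
  apply: near_eq_derivable qv _; apply: derivableM.
    by have [] := is_deriveB (fd x Bx) (is_derive_cst (f c) x 1).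
  by apply: derivableV; [rewrite subr_eq0|have [] := dc].
split=> //; have dq' : is_derive x 1 q (derive1 q x).
  by rewrite derive1E; apply: DeriveDef.
have e := is_deriveM dq' dc.
have : derive1 (q * (fun y => y - c)) x = derive1 f x.
  rewrite (_ : _ * _ = f - cst (f c)); last by apply/funext => y; rewrite !fctE -qE.
  by rewrite derive1E [LHS](@derive_val _ _ _ _ _ _ _
    (is_deriveB (fd x Bx) (is_derive_cst (f c) x 1))) subr0.
rewrite derive1E [X in X = _ -> _](@derive_val _ _ _ _ _ _ _ e) /GRing.scale /= => <-.
by ring.
Qed.

End Hadamard.

(** * The radial coordinate *)

Section Radius.
Context (R : realType).
Implicit Types (f p X Y : R -> R) (a b c d e x y r : R).

Lemma primitive_exists c d p : 0 < d ->
  (forall x, `|x - c| < d -> {for x, continuous p}) ->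
  exists P, forall x, `|x - c| < d / 2 -> is_derive x 1 P (p x).
Proof.
(* The radius 2d/3 lies strictly between d/2 and d: [p] is continuous on the closed interval, and
   the points where the derivative is wanted are interior to it. *)
move=> d0 pc; pose mu := @lebesgue_measure R.
pose a := c - 2 / 3 * d; pose b := c + 2 / 3 * d.
have pi : mu.-integrable `[a, b] (EFin \o p).
  apply: continuous_compact_integrable; first exact: segment_compact.
  apply: continuous_in_subspaceT => x; rewrite inE /= in_itv /= => /andP[ax xb].
  by apply: pc; rewrite ltr_norml; move: ax xb; rewrite /a /b; lra.
exists (fun x => \int[mu]_(t in [set` `[a, x]]) (p t)) => x.
rewrite ltr_norml => /andP[x1 x2].
have xb : x < b by rewrite /b; lra.
have ax : a < x by rewrite /a; lra.
have px : {for x, continuous p} by apply: pc; rewrite ltr_norml; lra.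
have [dP PE] := continuous_FTC1_closed xb pi ax px.
by rewrite -PE derive1E; apply: DeriveDef.
Qed.

Lemma is_derive_within_continuous X Y a b :
  (forall x, a <= x <= b -> is_derive x 1 X (Y x)) -> {within `[a, b], continuous X}.
Proof.
move=> XY; apply: continuous_in_subspaceT => x; rewrite inE /= in_itv /= => xab.
exact: is_derive_continuous (XY x xab).
Qed.

(** The inverse satisfies rho' = Y(rho), so each order of differentiability of rho yields the next
    from the smoothness of [Y]. *)
Lemma local_inverse c d X Y : 0 < d -> X c = 0 -> smooth_near c d Y ->
  (forall r, `|r - c| < d -> 0 < Y r /\ is_derive r 1 X (Y r)^-1) ->
  exists eps rho, [/\ 0 < eps, smooth_near 0 eps rho, rho 0 = c
    & forall x, `|x| < eps ->
      [/\ `|rho x - c| < d, X (rho x) = x & derive1 rho x = Y (rho x)] ].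
Proof.
move=> d0 Xc sY dX; pose a := c - d / 2; pose b := c + d / 2.
have ab_d x : a <= x <= b -> `|x - c| < d.
  by rewrite ltr_norml /a /b => /andP[? ?]; lra.
have dX' x : a <= x <= b -> is_derive x 1 X (Y x)^-1.
  by move=> /ab_d /dX[].
have Xcont : {within `[a, b], continuous X} by exact: is_derive_within_continuous dX'.
have Xinc x y : a <= x -> x < y -> y <= b -> X x < X y.
  apply: (@gtr0_derive1_incr R X a b) => // z; rewrite in_itv /= => /andP[/ltW az /ltW zb];
    have [Yz dz] := dX z (ab_d z (introT andP (conj az zb))).
    by have [] := dz.
  by rewrite derive1E derive_val invr_gt0.
have ac : a < c by rewrite /a; lra.
have cb : c < b by rewrite /b; lra.
have Xa : X a < 0 by have := Xinc a c (lexx _) ac (ltW cb); rewrite Xc.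
have Xb : 0 < X b by have := Xinc c b (ltW ac) cb (lexx _); rewrite Xc.
(* Since X a < 0 < X b, every value of modulus below [eps] is attained strictly between [a] and
   [b]. *)
pose eps := Num.min (- X a) (X b).
have eps0 : 0 < eps by rewrite lt_min oppr_gt0 Xa Xb.
(* The default [c] is returned only outside the range of [X] on the open interval. *)
pose rho x := xget c [set r | a < r < b /\ X r = x].
have rhoP x : (exists2 r, a < r < b & X r = x) -> a < rho x < b /\ X (rho x) = x.
  by move=> [r rab Xr]; rewrite /rho; case: xgetP => [_ -> []//|/(_ r)[]].
have inj r : a < r < b -> rho (X r) = r.
  move=> rab; have [] : a < rho (X r) < b /\ X (rho (X r)) = X r.
    by apply: rhoP; exists r.
  move: rab => /andP[ar rb] /andP[ar' rb'] XX.
  case: (ltgtP (rho (X r)) r) => // rr.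
    by have := Xinc _ _ (ltW ar') rr (ltW rb); rewrite XX ltxx.
  by have := Xinc _ _ (ltW ar) rr (ltW rb'); rewrite XX ltxx.
have rhoE x : `|x| < eps -> a < rho x < b /\ X (rho x) = x.
  rewrite ltr_norml lt_min ltrNl lt_min => /andP[/andP[x1 x2] /andP[x3 x4]]; apply: rhoP.
  have [||r] := @IVT R X a b x _ Xcont.
  - by rewrite ltW // (lt_trans ac cb).
  - by rewrite ge_min le_max; apply/andP; split; apply/orP; [left|right]; rewrite ltW //; lra.
  rewrite in_itv /= => /andP[ar rb] Xr; exists r => //.
  rewrite !lt_neqAle ar rb !andbT; apply/andP; split; apply/eqP => E.
    by move: x1 x2 x3 x4; rewrite -Xr -E; lra.
  by move: x1 x2 x3 x4; rewrite -Xr E; lra.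
have drho x : `|x| < eps -> is_derive x 1 rho (Y (rho x)).
  move=> xe; have [rab Xr] := rhoE x xe.
  have rab' : a <= rho x <= b by move: rab => /andP[/ltW -> /ltW ->].
  have [Y0 dXr] := dX (rho x) (ab_d _ rab').
  rewrite -[X in is_derive X]Xr -[Y _]invrK.
  have nab : \forall r \near rho x, a < r < b.
    apply: filterS (near_in_itvoo (_ : rho x \in `]a, b[)); last by rewrite in_itv.
    by move=> y; rewrite in_itv.
  apply: (@is_derive_inverse R X rho) => //.
  - by apply: filterS nab => r; apply: inj.
  - apply: filterS nab => r /andP[/ltW ar /ltW rb].
    by apply: is_derive_continuous (dX' r _); rewrite ar rb.
  - by rewrite invr_eq0 gt_eqF.
have rho_d x : `|x| < eps -> `|rho x - c| < d.
  by move=> /rhoE[/andP[/ltW ra /ltW rb] _]; apply: ab_d; rewrite ra rb.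
exists eps, rho; split=> //.
- apply/smooth_nearP => k; have Bo := @open_dist_lt R 0 eps.
  have xB (x : R) : [set x | `|x - 0| < eps] x -> `|x| < eps by rewrite /= subr0.
  elim: k => [//|k IH]; apply: ndiff_derive1 => //.
    by move=> x /xB/drho[].
  apply: (@eq_ndiff _ _ _ Bo _ (fun x => Y (rho x))).
    by move=> x /xB/drho dr; rewrite derive1E derive_val.
  move/smooth_nearP: sY => sY; apply: (ndiff_comp1 Bo _ (sY k) IH).
  by move=> x /xB/rho_d.
- by have := inj c; rewrite Xc ac cb; apply.
- move=> x xe; split; [exact: rho_d|by case: (rhoE x xe)|].
  by have dr := drho x xe; rewrite derive1E derive_val.
Qed.

Lemma smooth_near_gt0 c d f : 0 < d -> smooth_near c d f -> 0 < f c ->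
  exists2 e, 0 < e <= d & forall x, `|x - c| < e -> 0 < f x.
Proof.
move=> d0 sf fc0; have fc : {for c, continuous f}.
  by apply: smooth_near_continuous sf _; rewrite subrr normr0.
have /near_ball[e e0 eP] : \forall x \near c, 0 < f x by exact: cvgr_gt fc _ fc0.
exists (Num.min e d); first by rewrite lt_min e0 d0 ge_min lexx orbT.
by move=> x; rewrite lt_min => /andP[/eP].
Qed.

Lemma smooth_rsqrt : smooth_on [set x : R | 0 < x] (fun x => (Num.sqrt x)^-1).
Proof.
have Do : open [set x : R | 0 < x] by exact: open_gt.
have dphi x : 0 < x -> is_derive x 1 (fun x => (Num.sqrt x)^-1)
    (- 2^-1 * (Num.sqrt x)^-1 ^+ 3).
  move=> x0; have s0 : Num.sqrt x != 0 by rewrite gt_eqF // sqrtr_gt0.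
  apply: (is_derive_eq (is_deriveV s0 (is_derive1_sqrt x0))).
  by rewrite /GRing.scale /=; field.
(* The derivative of x^(-1/2) is -1/2 times its own cube, which is the bootstrap form with exponent
   3. *)
case=> [//|k]; apply: (@ndiff_ode _ _ _ Do _ _ 3 (fun v _ => - 2^-1 * v)).
- by move=> x /= /dphi dx; apply/derivable1_diffP.
- move=> v x /= /dphi dx; have /derivable1_diffP dx' : derivable (fun x => (Num.sqrt x)^-1) x 1.
    by have [] := dx.
  rewrite deriveE // -[in LHS](mulr1 v) [LHS]linearZ /= -mulrA mulrCA; congr (_ * _).
  have <- := derive_val (is_derive := dx).
  exact: esym (@deriveE R R R _ x 1 dx').
- by move=> v; apply: ndiff_cst.
Qed.

(** The null condition is stated squared: this form holds on both sides of the horizon without a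
    choice of sign for the root, and it is the one that the pullback needs. *)
Lemma kruskal_radius rH delta f h : 0 < delta ->
  smooth_near rH delta f -> smooth_near rH delta h -> f rH = 0 -> h rH = 0 ->
  0 < derive1 f rH -> 0 < derive1 h rH ->
  exists kappa eps rho, [/\ 0 < kappa, 0 < eps, smooth_near 0 eps rho, rho 0 = rH
    & forall x, `|x| < eps -> [/\ `|rho x - rH| < delta, 0 < derive1 rho x,
        (2 * kappa * (x * derive1 rho x)) ^+ 2 = f (rho x) * h (rho x)
      & 0 < x -> 0 < h (rho x)] ].
Proof.
move=> delta0 sf sh f0 h0 df0 dh0.
have [f1 [sf1 f1c fE]] := hadamard delta0 sf.
have [h1 [sh1 h1c hE]] := hadamard delta0 sh.
rewrite -f1c in df0; rewrite -h1c in dh0.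
have [d1 /andP[d1_gt0 d1_le] f1_gt0] := smooth_near_gt0 delta0 sf1 df0.
have [d2 /andP[d2_gt0 d2_le] h1_gt0] := smooth_near_gt0 d1_gt0 (smooth_near_sub d1_le sh1) dh0.
have {}f1_gt0 x : `|x - rH| < d2 -> 0 < f1 x by move=> xd; apply/f1_gt0/(lt_le_trans xd).
pose s x := f1 x * h1 x.
have s_gt0 x : `|x - rH| < d2 -> 0 < s x.
  by move=> xd; rewrite mulr_gt0 ?f1_gt0 ?h1_gt0.
have rHd : `|rH - rH| < d2 by rewrite subrr normr0.
have d2_delta : d2 <= delta by apply: le_trans d1_le.
(* With f h = (r - rH)^2 s, the logarithmic derivative of x in r is nu / (r - rH) for 2 kappa = sqrt
   (s rH). Normalising nu to 1 at rH makes its residue 1, so that x has a simple zero at the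
   horizon; this fixes kappa. *)
pose nu x := Num.sqrt (s rH) * (Num.sqrt (s x))^-1.
have Bo := @open_dist_lt R rH.
have ss : smooth_near rH d2 s.
  apply/smooth_nearP => k; apply: ndiffM; first exact: Bo.
    by have /smooth_nearP := smooth_near_sub d2_delta sf1.
  by have /smooth_nearP := smooth_near_sub d2_delta sh1.
have snu : smooth_near rH d2 nu.
  apply/smooth_nearP => k; apply: ndiffZ; first exact: Bo.
  apply: (ndiff_comp1 (Bo _) s_gt0 (smooth_rsqrt k)).
  by have /smooth_nearP := ss.
have nu_gt0 x : `|x - rH| < d2 -> 0 < nu x.
  by move=> xd; rewrite mulr_gt0 ?invr_gt0 ?sqrtr_gt0 ?s_gt0.
have nuE x : `|x - rH| < d2 -> nu x ^+ 2 * s x = s rH.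
  move=> xd; rewrite /nu exprMn exprVn !sqr_sqrtr ?ltW ?s_gt0 //.
  by rewrite mulfVK // gt_eqF // s_gt0.
have nu1 : nu rH = 1 by rewrite /nu divff // gt_eqF // sqrtr_gt0 s_gt0.
have [p [sp _ pE]] := hadamard d2_gt0 snu; rewrite nu1 in pE.
have [P dP] := primitive_exists d2_gt0 (fun x xd => smooth_near_continuous sp xd).
pose d := d2 / 2; have d_gt0 : 0 < d by rewrite divr_gt0.
have d_le : d <= d2 by rewrite /d; lra.
(* X' = nu * expR P, since nu = 1 + (r - rH) p: thus ln X is the tortoise
   coordinate rescaled by 2 kappa, and rho, the inverse of X, solves
   x rho' = (rho - rH) / nu(rho). *)
pose X r := (r - rH) * expR (P r); pose Y r := expR (- P r) / nu r.
have sP : smooth_on [set x | `|x - rH| < d] P.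
  case=> [//|k]; apply: ndiff_derive1 => //; first by move=> x /dP[].
  apply: (@eq_ndiff _ _ _ (Bo _) _ p); last by have /smooth_nearP := smooth_near_sub d_le sp.
  by move=> x /dP dPx; rewrite derive1E derive_val.
have sY : smooth_near rH d Y.
  apply/smooth_nearP => k; apply: ndiffM; first exact: Bo.
    apply: (@ndiff_comp1 _ _ _ (Bo _) _ setT) => //; first exact: smooth_expR openT k.
    by apply: ndiffN => //; apply: sP.
  apply: ndiffV; first exact: Bo.
    by move=> x xd; rewrite gt_eqF // nu_gt0 // (lt_le_trans xd).
  by have /smooth_nearP := smooth_near_sub d_le snu.
have dX r : `|r - rH| < d -> 0 < Y r /\ is_derive r 1 X (Y r)^-1.
  move=> rd; have rd2 := lt_le_trans rd d_le.
  split; first by rewrite divr_gt0 ?expR_gt0 ?nu_gt0.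
  have dPr := dP r rd.
  have dexp : is_derive r 1 (expR \o P) (expR (P r) * p r).
    by apply: is_derive1_comp.
  have drc := is_deriveB (is_derive_id r 1) (is_derive_cst rH r 1).
  apply: (is_derive_eq (is_deriveM drc dexp)).
  rewrite /Y invfM invrK expRN invrK pE /GRing.scale /=.
  by rewrite -[(id - cst rH) r]/(r - rH) subr0; ring.
have Xc : X rH = 0 by rewrite /X subrr mul0r.
have [eps [rho [eps_gt0 srho rho0 rhoP]]] := local_inverse d_gt0 Xc sY dX.
exists (Num.sqrt (s rH) / 2), eps, rho; split=> //.
  by rewrite divr_gt0 // sqrtr_gt0 s_gt0.
move=> x /rhoP[rd Xr dr]; have rd2 := lt_le_trans rd d_le.
have nu0 := nu_gt0 _ rd2; have e0 := expR_gt0 (P (rho x)).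
split; [exact: lt_le_trans d2_delta|by rewrite dr; have [] := dX _ rd| |].
- have -> : x * derive1 rho x = (rho x - rH) / nu (rho x).
    rewrite dr; move: (rho x) nu0 e0 Xr => y nu0 _ <-; rewrite /X /Y expRN.
    by field; rewrite !gt_eqF ?expR_gt0.
  rewrite fE hE f0 h0 !add0r.
  transitivity ((rho x - rH) ^+ 2 * (Num.sqrt (s rH) ^+ 2 / nu (rho x) ^+ 2)).
    have : nu (rho x) != 0 by rewrite gt_eqF.
    by move: (nu _) (Num.sqrt _) => n t n0; field.
  rewrite sqr_sqrtr ?ltW ?s_gt0 // -(nuE _ rd2) [nu _ ^+ 2 * _]mulrC mulfK.
    by rewrite /s; ring.
  by rewrite expf_neq0 // gt_eqF.
- move=> x0; rewrite hE h0 add0r mulr_gt0 ?h1_gt0 //.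
  by rewrite -(pmulr_lgt0 _ e0) -/(X (rho x)) Xr.
Qed.

End Radius.

(** * The Kruskal chart *)

Section Pullback.
Context (R : realType).
Implicit Types (J A B : 'M[R]_5) (a b : 'rV[R]_5).

Lemma congruence_sprod J a b :
  J *m sprod a b *m J^T = sprod (a *m J^T) (b *m J^T).
Proof.
rewrite /sprod -scalemxAr -scalemxAl mulmxDr mulmxDl !trmx_mul !trmxK.
by rewrite !mulmxA.
Qed.

(** Pulling back a line element amounts to replacing each coordinate differential by its pullback,
    the covector [dx k *m J^T]. *)
Lemma black_hole_metric_congruence f h omega N M J (q : 'rV[R]_5) :
  let r := q 0 ix1 in let theta := q 0 ix2 in
  let e k := dx R k *m J^T in
  J *m black_hole_metric f h omega N M q *m J^T =
  - f r *: ssq (e ix0) + (h r)^-1 *: ssq (e ix1)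
  + N r *: ssq (omega r *: e ix0 - sin theta ^+ 2 *: e ix3 - cos theta ^+ 2 *: e ix4)
  + M r *: ssq (e ix2)
  + (M r * sin theta ^+ 2 * cos theta ^+ 2) *: ssq (e ix3 - e ix4).
Proof.
have cD A B : J *m (A + B) *m J^T = J *m A *m J^T + J *m B *m J^T.
  by rewrite mulmxDr mulmxDl.
have cS k a b : J *m (k *: sprod a b) *m J^T = k *: sprod (a *m J^T) (b *m J^T).
  by rewrite -scalemxAr -scalemxAl congruence_sprod.
have eB a b : (a - b) *m J^T = a *m J^T - b *m J^T by rewrite mulmxBl.
have eZ k a : (k *: a) *m J^T = k *: (a *m J^T) by rewrite scalemxAl.
by rewrite /black_hole_metric /= /ssq !cD !cS !(eB, eZ).
Qed.

End Pullback.

Section Chart.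
Context (R : realType) (kappa Omega : R) (rho : R -> R) (p : 'rV[R]_5).
Let U := p 0 ix0.
Let V := p 0 ix1.
Hypotheses (k0 : 0 < kappa) (U0 : 0 < U) (V0 : 0 < V).
Hypothesis drho : derivable rho (U * V) 1.
Let Phi := kruskal_chart kappa Omega rho.

Definition chart_t (q : 'rV[R]_5) := ln (q 0 ix1 / q 0 ix0) / (2 * kappa).

Lemma kruskal_chartE q :
  [/\ Phi q 0 ix0 = chart_t q, Phi q 0 ix1 = rho (q 0 ix0 * q 0 ix1),
      Phi q 0 ix2 = q 0 ix2, Phi q 0 ix3 = q 0 ix3 + Omega * chart_t q
    & Phi q 0 ix4 = q 0 ix4 + Omega * chart_t q].
Proof. by rewrite /chart_t; split; rewrite !mxE /=; ring. Qed.

Lemma is_derive_chart_t (v : 'rV[R]_5) :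
  is_derive p v chart_t ((2 * kappa)^-1 * (v 0 ix1 / V - v 0 ix0 / U)).
Proof.
have UN0 : U != 0 by rewrite gt_eqF.
have dU : differentiable (fun q : 'rV[R]_5 => q 0 ix0) p by exact: differentiable_coord.
have dV : differentiable (fun q : 'rV[R]_5 => q 0 ix1) p by exact: differentiable_coord.
have dUV : differentiable (fun q : 'rV[R]_5 => q 0 ix1 / q 0 ix0) p.
  by apply: differentiableM => //; apply: differentiableV.
have VU0 : 0 < V / U by rewrite divr_gt0.
have dln := is_derive1_ln VU0.
have dlnUV : differentiable ((@ln R) \o (fun q : 'rV[R]_5 => q 0 ix1 / q 0 ix0)) p.
  by apply: (differentiable_comp dUV); apply/derivable1_diffP; have [] := dln.
have ct : chart_t = (2 * kappa)^-1 *: ((@ln R) \o (fun q : 'rV[R]_5 => q 0 ix1 / q 0 ix0)).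
  by apply/funext => q; rewrite /chart_t /= mulrC.
rewrite ct; apply: DeriveDef.
  by apply: derivableZ; apply: diff_derivable.
rewrite deriveZ; last exact: diff_derivable.
have eU := is_derive_coord ix0 p v; have eV := is_derive_coord ix1 p v.
have eUV : is_derive p v (fun q : 'rV[R]_5 => q 0 ix1 / q 0 ix0)
    (v 0 ix1 / U - V * v 0 ix0 / U ^+ 2).
  have eUi : is_derive p v (fun q : 'rV[R]_5 => (q 0 ix0)^-1) (- U ^- 2 *: v 0 ix0).
    have [dU' eU'] := eU; apply: DeriveDef; first exact: derivableV UN0 dU'.
    by rewrite (deriveV UN0 dU') eU'.
  apply: (is_derive_eq (is_deriveM eV eUi)).
  by rewrite /GRing.scale /= -/U -/V; field.
have -> : 'D_v ((@ln R) \o (fun q : 'rV[R]_5 => q 0 ix1 / q 0 ix0)) p =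
    (V / U)^-1 * (v 0 ix1 / U - V * v 0 ix0 / U ^+ 2).
  transitivity ('D_1 (@ln R) (V / U) *
      'D_v (fun q : 'rV[R]_5 => q 0 ix1 / q 0 ix0) p).
    by apply: (derive_comp1 _ dUV); have [] := dln.
  congr (_ * _); first exact: (@derive_val _ _ _ _ _ _ _ dln).
  exact: (@derive_val _ _ _ _ _ _ _ eUV).
rewrite /GRing.scale /=.
by field; rewrite !gt_eqF.
Qed.

Lemma is_derive_chart_r (v : 'rV[R]_5) :
  is_derive p v (fun q : 'rV[R]_5 => rho (q 0 ix0 * q 0 ix1))
    (derive1 rho (U * V) * (U * v 0 ix1 + V * v 0 ix0)).
Proof.
have eU := is_derive_coord ix0 p v; have eV := is_derive_coord ix1 p v.
have dUV : differentiable (fun q : 'rV[R]_5 => q 0 ix0 * q 0 ix1) p.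
  by apply: differentiableM; apply: differentiable_coord.
apply: DeriveDef.
  by apply/diff_derivable/differentiable_comp => //; apply/derivable1_diffP.
rewrite -[fun q => _]/(rho \o (fun q : 'rV[R]_5 => q 0 ix0 * q 0 ix1)) derive_comp1 //.
rewrite derive1E; congr (_ * _).
by rewrite [LHS](@derive_val _ _ _ _ _ _ _ (is_deriveM eU eV)).
Qed.

Lemma differentiable_chart_t : differentiable chart_t p.
Proof.
have UN0 : U != 0 by rewrite gt_eqF.
apply: differentiableM; last exact: differentiable_cst.
apply: (@differentiable_comp _ _ _ _ (fun q : 'rV[R]_5 => q 0 ix1 / q 0 ix0) (@ln R)).
  apply: differentiableM; first exact: differentiable_coord.
  by apply: differentiableV => //; apply: differentiable_coord.
have VU0 : 0 < V / U by rewrite divr_gt0.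
by apply/derivable1_diffP; have [] := is_derive1_ln VU0.
Qed.

Lemma differentiable_chart : differentiable Phi p.
Proof.
have dt := differentiable_chart_t.
have E i (f : 'rV[R]_5 -> R) : (forall q, Phi q 0 i = f q) ->
    differentiable f p -> differentiable (fun q => Phi q 0 i) p.
  by move=> fE; rewrite (_ : (fun q => _) = f) //; apply/funext => q; apply: fE.
have dx' i : differentiable (fun q : 'rV[R]_5 => q 0 i) p by exact: differentiable_coord.
apply: differentiable_rV; apply: ord5_ind.
- by apply: (E _ chart_t) => // q; case: (kruskal_chartE q).
- apply: (E _ (fun q => rho (q 0 ix0 * q 0 ix1))) => [q|]; first by case: (kruskal_chartE q).
  apply: (@differentiable_comp _ _ _ _ (fun q : 'rV[R]_5 => q 0 ix0 * q 0 ix1)).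
    by apply: differentiableM.
  exact/derivable1_diffP.
- by apply: (E _ (fun q => q 0 ix2)) => // q; case: (kruskal_chartE q).
- apply: (E _ (fun q => q 0 ix3 + Omega * chart_t q)) => [q|]; first by case: (kruskal_chartE q).
  by apply: differentiableD => //; apply: differentiableZ.
- apply: (E _ (fun q => q 0 ix4 + Omega * chart_t q)) => [q|]; first by case: (kruskal_chartE q).
  by apply: differentiableD => //; apply: differentiableZ.
Qed.

Lemma jacobianE i k : ('J Phi p) i k = 'D_(delta_mx 0 i) (fun q => Phi q 0 k) p.
Proof.
have d := differentiable_chart.
have e : 'D_(delta_mx 0 i) Phi p = row i ('J Phi p).
  by rewrite deriveEjacobian // rowE.
have -> : ('J Phi p) i k = (row i ('J Phi p)) 0 k by rewrite [RHS]mxE.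
by rewrite -e (derive_mx (diff_derivable d)) mxE.
Qed.

Definition dt_kruskal := (2 * kappa)^-1 *: (V^-1 *: dx R ix1 - U^-1 *: dx R ix0).

Lemma chart_dx :
  let e k := dx R k *m ('J Phi p)^T in
  [/\ e ix0 = dt_kruskal,
      e ix1 = derive1 rho (U * V) *: (U *: dx R ix1 + V *: dx R ix0),
      e ix2 = dx R ix2, e ix3 = dx R ix3 + Omega *: dt_kruskal
    & e ix4 = dx R ix4 + Omega *: dt_kruskal].
Proof.
have eE k (w : 'rV[R]_5) (f : 'rV[R]_5 -> R) : (forall q, Phi q 0 k = f q) ->
    (forall i, is_derive p (delta_mx 0 i) f (w 0 i)) -> dx R k *m ('J Phi p)^T = w.
  move=> fE df; rewrite -rowE; apply/rowP => i; rewrite [LHS]mxE [LHS]mxE jacobianE.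
  by rewrite (_ : (fun q => _) = f); [have [] := df i|apply/funext].
have dtE i : is_derive p (delta_mx 0 i) chart_t (dt_kruskal 0 i).
  apply: (is_derive_eq (is_derive_chart_t _)); rewrite !mxE /= !(eq_sym i).
  ring.
move=> e; split.
- by apply: eE dtE => q; case: (kruskal_chartE q).
- apply: (eE _ _ (fun q => rho (q 0 ix0 * q 0 ix1))) => [q|i]; first by case: (kruskal_chartE q).
  by apply: (is_derive_eq (is_derive_chart_r _)); rewrite !mxE /= !(eq_sym i).
- apply: (eE _ _ (fun q => q 0 ix2)) => [q|i]; first by case: (kruskal_chartE q).
  by apply: (is_derive_eq (is_derive_coord _ _ _)); rewrite !mxE /= !(eq_sym i).
- apply: (eE _ _ (fun q => q 0 ix3 + Omega * chart_t q)) => [q|i]; first by case: (kruskal_chartE q).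
  apply: (is_derive_eq (is_deriveD (is_derive_coord ix3 p _) (is_deriveZ Omega (dtE i)))).
  by rewrite !mxE /= !(eq_sym i).
- apply: (eE _ _ (fun q => q 0 ix4 + Omega * chart_t q)) => [q|i]; first by case: (kruskal_chartE q).
  apply: (is_derive_eq (is_deriveD (is_derive_coord ix4 p _) (is_deriveZ Omega (dtE i)))).
  by rewrite !mxE /= !(eq_sym i).
Qed.

End Chart.

(** * The black hole metric *)

Section BlackHole.
Context (R : realType).

(* Here [(2 kappa x rho')^2 = f h] says that U and V are null in the (t, r) plane. *)
Lemma pullback_black_hole (kappa Omega : R) (f h omega N M rho F W : R -> R)
    (p : 'rV[R]_5) :
  let x := p 0 ix0 * p 0 ix1 in
  0 < kappa -> 0 < p 0 ix0 -> 0 < p 0 ix1 -> derivable rho x 1 ->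
  (2 * kappa * (x * derive1 rho x)) ^+ 2 = f (rho x) * h (rho x) ->
  h (rho x) != 0 -> F x != 0 ->
  f (rho x) = 2 * kappa ^+ 2 * x * F x ->
  omega (rho x) - Omega = 2 * kappa * x * W x ->
  pullback (kruskal_chart kappa Omega rho) (black_hole_metric f h omega N M) p =
  kruskal_metric F (N \o rho) (M \o rho) W p.
Proof.
move=> x k0 U0 V0 drho fh h0 F0 fE oE; rewrite /pullback black_hole_metric_congruence.
have [-> -> -> -> ->] := chart_dx Omega k0 U0 V0 drho.
have [_ -> -> _ _] := kruskal_chartE kappa Omega rho p.
rewrite /kruskal_metric -/x /=; set r := rho x in fh h0 fE oE *.
set U := p 0 ix0; set V := p 0 ix1.
set theta := p 0 ix2; set w := dt_kruskal kappa p.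
have sc : sin theta ^+ 2 = 1 - cos theta ^+ 2.
  by rewrite -(cos2Dsin2 theta); ring.
have U0' : U != 0 by rewrite gt_eqF.
have V0' : V != 0 by rewrite gt_eqF.
have k0' : kappa != 0 by rewrite gt_eqF.
(* As sin^2 + cos^2 = 1, the co-rotation of the two angles subtracts Omega from omega. The
   difference 2 kappa U V W cancels the poles of dt and leaves W (U dV - V dU). *)
have -> : omega r *: w - sin theta ^+ 2 *: (dx R ix3 + Omega *: w)
    - cos theta ^+ 2 *: (dx R ix4 + Omega *: w) =
  W x *: (U *: dx R ix1 - V *: dx R ix0)
    - sin theta ^+ 2 *: dx R ix3 - cos theta ^+ 2 *: dx R ix4.
  have oE' : omega r = Omega + 2 * kappa * (U * V) * W x by rewrite -oE; ring.
  rewrite oE' sc; apply/rowP => i.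
  have aE (a b : 'rV[R]_5) : (a + b) 0 i = a 0 i + b 0 i by rewrite mxE.
  have bE (a : 'rV[R]_5) : (- a) 0 i = - a 0 i by rewrite mxE.
  have zE c (a : 'rV[R]_5) : (c *: a) 0 i = c * a 0 i by rewrite mxE.
  rewrite /w /dt_kruskal !(aE, bE, zE) -/U -/V.
  by field; rewrite U0' V0' k0'.
have -> : dx R ix3 + Omega *: w - (dx R ix4 + Omega *: w) = dx R ix3 - dx R ix4.
  by rewrite opprD addrACA subrr addr0.
(* The null condition cancels the dU^2 and dV^2 terms and makes the two cross terms equal. Together
   they are f / (kappa^2 x) dU dV, whence f = 2 kappa^2 x F. *)
suff -> : - f r *: ssq w
    + (h r)^-1 *: ssq (derive1 rho x *: (U *: dx R ix1 + V *: dx R ix0)) =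
  (2 * F x) *: sprod (dx R ix0) (dx R ix1) by [].
apply/matrixP => i j.
have aE (A B : 'M[R]_5) : (A + B) i j = A i j + B i j by rewrite mxE.
have zE c (A : 'M[R]_5) : (c *: A) i j = c * A i j by rewrite mxE.
have mE (a b : 'rV[R]_5) : (a^T *m b) i j = a 0 i * b 0 j.
  by rewrite mxE big_ord1 mxE.
have vE k (a b : 'rV[R]_5) : (a + b) 0 k = a 0 k + b 0 k by rewrite mxE.
have wE k (a : 'rV[R]_5) : (- a) 0 k = - a 0 k by rewrite mxE.
have uE k c (a : 'rV[R]_5) : (c *: a) 0 k = c * a 0 k by rewrite mxE.
have x0 : x != 0 by rewrite mulf_neq0.
have f0 : f r != 0 by rewrite fE !mulf_neq0 // ?expf_neq0 // pnatr_eq0.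
have d0 : derive1 rho x != 0.
  apply: contraNneq (mulf_neq0 f0 h0) => d0.
  by rewrite -fh d0 !mulr0 expr0n.
have hE : (h r)^-1 = f r / (2 * kappa * (x * derive1 rho x)) ^+ 2.
  by rewrite fh invfM mulrA divff ?mul1r.
rewrite /ssq /sprod /w /dt_kruskal !(aE, zE, mE, vE, wE, uE) -/U -/V -/x hE fE.
rewrite /x -/U -/V; move: d0; rewrite /x -/U -/V.
move: (derive1 rho _) (F _) => D G D0.
move: (dx R ix0 0 i) (dx R ix1 0 i) (dx R ix0 0 j) (dx R ix1 0 j) => a b c d.
by field; rewrite U0' V0' k0' D0.
Qed.

Theorem black_hole_kruskal_form (rH delta : R) (f h omega N M : R -> R) :
  regular_horizon rH delta f h omega N M ->
  exists (kappa eps : R) (rho F N' M' W : R -> R),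
    [/\ kruskal_data eps F N' M' W
      & takes_kruskal_form (black_hole_metric f h omega N M)
          rH delta kappa (omega rH) eps rho F N' M' W].
Proof.
case=> delta0 sf sh so sN sM N0 M0 f0 h0 df0 dh0 do0.
have [kappa [eps0 [rho [k0 eps0_gt0 srho rho0 rhoP]]]] :=
  kruskal_radius delta0 sf sh f0 h0 df0 dh0.
have k0' : kappa != 0 by rewrite gt_eqF.
have zero_eps : `|0 : R| < eps0 by rewrite normr0.
have Bo := @open_dist_lt R 0 eps0.
have rho_near x : `|x - 0| < eps0 -> `|rho x - rH| < delta.
  by rewrite subr0 => /rhoP[].
have comp_smooth u : smooth_near rH delta u -> smooth_near 0 eps0 (u \o rho).
  move=> /smooth_nearP su; apply/smooth_nearP => k.
  by apply: (ndiff_comp1 Bo _ (su k)); [exact: rho_near|have /smooth_nearP := srho].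
have comp_derive u : smooth_near rH delta u ->
    derive1 (u \o rho) 0 = derive1 u rH * derive1 rho 0.
  move=> su; rewrite derive1_comp ?rho0 //; first by apply: (srho 0); rewrite subrr.
  by apply: (su 0); rewrite subrr normr0.
have drho0 : 0 < derive1 rho 0 by case: (rhoP 0 zero_eps).
have [qf [sqf qf0 qfE]] := hadamard eps0_gt0 (comp_smooth _ sf).
have [qo [sqo qo0 qoE]] := hadamard eps0_gt0 (comp_smooth _ so).
have scale_smooth c u : smooth_near 0 eps0 u -> smooth_near 0 eps0 (fun x => c * u x).
  by move=> /smooth_nearP su; apply/smooth_nearP => k; apply: ndiffZ.
(* At 0 these are non-zero multiples of f'(rH) rho'(0) and omega'(rH) rho'(0). *)
pose F x := (2 * kappa ^+ 2)^-1 * qf x; pose W x := (2 * kappa)^-1 * qo x.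
have F0 : F 0 != 0.
  rewrite mulf_neq0 ?invr_eq0 ?mulf_neq0 ?expf_neq0 ?pnatr_eq0 //.
  by rewrite qf0 comp_derive // mulf_neq0 // gt_eqF.
have W0 : W 0 != 0.
  rewrite mulf_neq0 ?invr_eq0 ?mulf_neq0 ?expf_neq0 ?pnatr_eq0 //.
  by rewrite qo0 comp_derive // mulf_neq0 // gt_eqF.
have kd0 : kruskal_data eps0 F (N \o rho) (M \o rho) W.
  split; [exact: eps0_gt0|exact: scale_smooth|exact: comp_smooth
    |exact: comp_smooth|exact: scale_smooth|exact: F0|exact: W0| |].
    by move=> x xe; apply: N0; apply: rho_near; rewrite subr0.
  by move=> x xe; apply: M0; apply: rho_near; rewrite subr0.
have [eps eps_eps0 Fe] := smooth_near_neq0 eps0_gt0 (kruskal_smoothF kd0) F0.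
have [eps_gt0 eps_le] := andP eps_eps0.
have kd := kruskal_data_sub eps_eps0 kd0.
exists kappa, eps, rho, F, (N \o rho), (M \o rho), W; split; first exact: kd.
split; [exact: k0|exact: smooth_near_sub srho|exact: rho0| | |].
- by move=> x xe; case: (rhoP x (lt_le_trans xe eps_le)).
- by move=> x xe; case: (rhoP x (lt_le_trans xe eps_le)).
move=> p U0 V0 UV p_theta Phi; set x := p 0 ix0 * p 0 ix1 in UV.
have x_gt0 : 0 < x by rewrite mulr_gt0.
have xe : `|x| < eps by rewrite gtr0_norm.
have Fx : F x != 0 by apply: Fe; rewrite subr0.
have [_ _ fh hx] := rhoP x (lt_le_trans xe eps_le).
have drho : derivable rho x 1.
  by apply: (srho 0); rewrite subr0 (lt_le_trans xe).
have pE : pullback Phi (black_hole_metric f h omega N M) p =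
    kruskal_metric F (N \o rho) (M \o rho) W p.
  apply: pullback_black_hole => //.
  - by rewrite gt_eqF // hx.
  - have := qfE x; rewrite /= rho0 f0 add0r subr0 => ->.
    by rewrite /F -/x; move: (qf x) => y; field.
  - have := qoE x; rewrite /= rho0 subr0 => ->.
    by rewrite /W -/x; move: (qo x) => y; field.
split; [exact: differentiable_chart| |exact: pE].
(* The pulled-back metric is invertible, and being J g J^T it forces the Jacobian matrix to be
   invertible as well; no determinant of the chart is computed. *)
have := kruskal_unit W Fx (kruskal_M_gt0 kd xe) (kruskal_N_gt0 kd xe) p_theta.
by rewrite -pE /pullback !unitmx_mul => /andP[/andP[]].
Qed.

End BlackHole.

Theorem mainTheorem8 (R : realType) :
  (forall (eps : R) (F N M W : R -> R), kruskal_data eps F N M W ->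
     let g := kruskal_metric F N M W in
     horizon_types g (weyl g) /\ horizon_types g (riemann g))
  /\
  (forall (rH delta : R) (f h omega N M : R -> R),
     regular_horizon rH delta f h omega N M ->
     exists (kappa eps : R) (rho F N' M' W : R -> R),
       [/\ kruskal_data eps F N' M' W,
           takes_kruskal_form (black_hole_metric f h omega N M)
             rH delta kappa (omega rH) eps rho F N' M' W
         & let g := kruskal_metric F N' M' W in
           horizon_types g (weyl g) /\ horizon_types g (riemann g)]).
Proof.
split; first exact: kruskal_horizon_types.
move=> rH delta f h omega N M.
move=> /black_hole_kruskal_form[kappa [eps [rho [F [N' [M' [W [kd kf]]]]]]]].
exists kappa, eps, rho, F, N', M', W; split; [exact: kd|exact: kf|].
exact: kruskal_horizon_types kd.
Qed.
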